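(* Let $R$ be a commutative ring and let $J$ be a Freudenthal $R$-algebra. Every outer ideal of $J$ is an ideal of $J$. The maps $I\mapsto I\cap R1_J$ (viewed as an ideal of $R$ via the identification $R\cong R1_J$) and $\mathfrak{a}\mapsto\mathfrak{a}J$ are bijections between the set of outer ideals $I$ of $J$ and the set of ideals $\mathfrak{a}$ of $R$.
   Context: A quadratic map between $R$-modules is a polynomial law homogeneous of degree 2. A para-quadratic $R$-algebra is an $R$-module $J$ with a quadratic map $U:J\to\mathrm{End}_R(J)$, $x\mapsto U_x$, and an element $1_J$ with $U_{1_J}=\mathrm{Id}_J$; put $\{xyz\}=(U_{x+z}-U_x-U_z)y$. Homomorphisms are $R$-linear maps preserving $1$ and satisfying $\phi(U_xy)=U_{\phi(x)}\phi(y)$. Ideals. For subsets $A,B$ of $J$ write $U_AB$ for the $R$-span of all $U_ab$ ($a\in A,b\in B$), and $\{JJI\}$ for the $R$-span of all $\{xyz\}$ with $x,y\in J$, $z\in I$. An $R$-submodule $I\subseteq J$ is an ideal if $U_IJ+U_JI+\{JJI\}=I$, and an outer ideal if $U_JI+\{JJI\}=I$. Composition algebras. A composition $R$-algebra is a unital, not necessarily associative $R$-algebra $C$, finitely generated projective as an $R$-module, with a quadratic form $n_C$ such that $n_C(xy)=n_C(x)n_C(y)$, $n_C(1_C)=1$, and $n_C(x,y):=n_C(x+y)-n_C(x)-n_C(y)$ induces an isomorphism $C\to C^*$. Put $\mathrm{Tr}_C(x)=n_C(x,1_C)$, $\bar x=\mathrm{Tr}_C(x)1_C-x$. One can write $R=\prod_{e=0}^3R_e$,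 $C=\prod_{e=0}^3 C_e$ with $C_e$ a composition $R_e$-algebra of constant rank $2^e$ (in rank 1, $C_0=R_0$ with norm $\alpha^2$, and 2 is invertible in $R_0$). $C$ is split if $C_1\cong R_1\times R_1$, $C_2\cong\mathrm{Mat}_2(R_2)$, and $C_3\cong\mathrm{Zor}(R_3)$. Here $\mathrm{Zor}(R)$ is the module of matrices $\begin{pmatrix}\alpha_1&u\\ x&\alpha_2\end{pmatrix}$, $\alpha_i\in R$, $u,x\in R^3$, with product $$\begin{pmatrix}\alpha_1&u\\ x&\alpha_2\end{pmatrix}\begin{pmatrix}\beta_1&v\\ y&\beta_2\end{pmatrix}=\begin{pmatrix}\alpha_1\beta_1-u^{\top}y&\alpha_1v+\beta_2u+x\times y\\ \beta_1x+\alpha_2y+u\times v&-x^{\top}v+\alpha_2\beta_2\end{pmatrix}$$ and norm $\alpha_1\alpha_2+u^\top x$. Freudenthal algebras. $\mathrm{Her}_3(C)$ is the $R$-module of matrices $$x=\begin{pmatrix}\alpha_1&c_3&\bar c_2\\ \bar c_3&\alpha_2&c_1\\ c_2&\bar c_1&\alpha_3\end{pmatrix},\quad\alpha_i\in R,\ c_i\in C.$$ With $x$ having coordinates $(\alpha_i,c_i)$ and $y$ coordinates $(\beta_i,d_i)$, indices mod 3, put $T(x,y)=\sum_i(\alpha_i\beta_i+n_C(c_i,d_i))$; let $x^\sharp$ have coordinates $(\alpha_{i+1}\alpha_{i+2}-n_C(c_i),\,-\alpha_ic_i+\overline{c_{i+1}c_{i+2}})$; $x\times y=(x+y)^\sharp-x^\sharp-y^\sharp$.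 The identity matrix and $U_xy=T(x,y)x-x^\sharp\times y$ make $\mathrm{Her}_3(C)$ a para-quadratic algebra. A split Freudenthal $R$-algebra is $\mathrm{Her}_3(C)$ with $C$ a split composition $R$-algebra. A Freudenthal $R$-algebra is a para-quadratic $R$-algebra $J$ such that $J\otimes S$ is isomorphic to a split Freudenthal $S$-algebra for some faithfully flat commutative $R$-algebra $S$. For such $J$, $1_J$ is unimodular (i.e. $\lambda(1_J)=1$ for some $\lambda\in J^*$), so $R\to R1_J$ is an isomorphism. *)

(* Defs.v *)
From HB Require Import structures.
From mathcomp Require Import all_boot all_order all_algebra.
From mathcomp Require Import ring.
From mathcomp Require Import boolp classical_sets functions.

Set Implicit Arguments.
Unset Strict Implicit.
Unset Printing Implicit Defensive.

Import GRing.Theory.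
Local Open Scope ring_scope.
Local Open Scope quotient_scope.

Section Tensor.
Variables (R S : comPzRingType) (f : {rmorphism R -> S}) (M : lmodType R).

(* The list [:: (m1, s1); ...; (mk, sk)] stands for the formal sum
   m1 (x) s1 + ... + mk (x) sk.  The relation below is the congruence
   generated by the defining relations of M (x)_R S; opposites are
   (- m) (x) s. *)
Definition presum := seq (M * S).

Inductive presum_eq : presum -> presum -> Prop :=
| presum_refl l : presum_eq l l
| presum_sym l l' : presum_eq l l' -> presum_eq l' l
| presum_trans l l' l'' : presum_eq l l' -> presum_eq l' l'' -> presum_eq l l''
| presum_cat l1 l1' l2 l2' :
    presum_eq l1 l1' -> presum_eq l2 l2' -> presum_eq (l1 ++ l2) (l1' ++ l2')
| presum_catC l1 l2 : presum_eq (l1 ++ l2) (l2 ++ l1)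
| presum_0 s : presum_eq [:: (0, s)] [::]
| presum_Dl m m' s : presum_eq [:: (m + m', s)] [:: (m, s); (m', s)]
| presum_Dr m s s' : presum_eq [:: (m, s + s')] [:: (m, s); (m, s')]
| presum_Z r m s : presum_eq [:: (r *: m, s)] [:: (m, f r * s)].

Definition presum_eqb (l l' : presum) : bool := `[< presum_eq l l' >].

Fact presum_eqb_refl : reflexive presum_eqb.
Proof. by move=> l; apply/asboolP; exact: presum_refl. Qed.
Fact presum_eqb_sym : symmetric presum_eqb.
Proof.
by move=> l l'; apply/idP/idP => /asboolP h; apply/asboolP; exact: presum_sym.
Qed.
Fact presum_eqb_trans : transitive presum_eqb.
Proof.
move=> l l' l'' /asboolP h /asboolP h'; apply/asboolP.
exact: presum_trans h h'.
Qed.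

Canonical presum_equiv :=
  EquivRel presum_eqb presum_eqb_refl presum_eqb_sym presum_eqb_trans.

Definition tensor := {eq_quot presum_equiv}.
HB.instance Definition _ := Choice.on tensor.

Definition tpi (l : presum) : tensor := \pi_tensor l.

Lemma tpiP l l' : tpi l = tpi l' <-> presum_eq l l'.
Proof.
split=> [/eqquotP/asboolP //|h]; exact/eqquotP/asboolP.
Qed.

Lemma tpiK (x : tensor) : tpi (repr x) = x.
Proof. exact: reprK. Qed.

Definition presum_opp (l : presum) : presum := [seq (- p.1, p.2) | p <- l].
Definition presum_scale (a : S) (l : presum) : presum :=
  [seq (p.1, a * p.2) | p <- l].

Lemma presum_scale_eq a l l' :
  presum_eq l l' -> presum_eq (presum_scale a l) (presum_scale a l').
Proof.
rewrite /presum_scale; elim=> {l l'} /=.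
- by move=> l; exact: presum_refl.
- by move=> l l' _; exact: presum_sym.
- by move=> l l' l'' _ h _; exact: presum_trans.
- by move=> l1 l1' l2 l2' _ h1 _ h2; rewrite !map_cat; exact: presum_cat.
- by move=> l1 l2; rewrite !map_cat; exact: presum_catC.
- by move=> s; exact: presum_0.
- by move=> m m' s; exact: presum_Dl.
- by move=> m s s'; rewrite mulrDr; exact: presum_Dr.
- by move=> r m s; rewrite mulrCA; exact: presum_Z.
Qed.

Lemma presum_opp_eq l l' :
  presum_eq l l' -> presum_eq (presum_opp l) (presum_opp l').
Proof.
rewrite /presum_opp; elim=> {l l'} /=.
- by move=> l; exact: presum_refl.
- by move=> l l' _; exact: presum_sym.
- by move=> l l' l'' _ h _; exact: presum_trans.
- by move=> l1 l1' l2 l2' _ h1 _ h2; rewrite !map_cat; exact: presum_cat.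
- by move=> l1 l2; rewrite !map_cat; exact: presum_catC.
- by move=> s; rewrite oppr0; exact: presum_0.
- by move=> m m' s; rewrite opprD; exact: presum_Dl.
- by move=> m s s'; exact: presum_Dr.
- by move=> r m s; rewrite -scalerN; exact: presum_Z.
Qed.

Definition tadd (x y : tensor) : tensor := tpi (repr x ++ repr y).
Definition topp (x : tensor) : tensor := tpi (presum_opp (repr x)).
Definition tscale (a : S) (x : tensor) : tensor :=
  tpi (presum_scale a (repr x)).

Lemma presum_repr l : presum_eq (repr (tpi l)) l.
Proof. by apply/tpiP; rewrite tpiK. Qed.

Lemma tadd_pi l l' : tadd (tpi l) (tpi l') = tpi (l ++ l').
Proof. by apply/tpiP; apply: presum_cat; exact: presum_repr. Qed.
Lemma topp_pi l : topp (tpi l) = tpi (presum_opp l).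
Proof. by apply/tpiP/presum_opp_eq/presum_repr. Qed.
Lemma tscale_pi a l : tscale a (tpi l) = tpi (presum_scale a l).
Proof. by apply/tpiP/presum_scale_eq/presum_repr. Qed.

Lemma tensor_piW (P : tensor -> Prop) : (forall l, P (tpi l)) -> forall x, P x.
Proof. by move=> h x; rewrite -(tpiK x). Qed.

Fact taddA : associative tadd.
Proof.
elim/tensor_piW=> a; elim/tensor_piW=> b; elim/tensor_piW=> c.
by rewrite !tadd_pi catA.
Qed.
Fact taddC : commutative tadd.
Proof.
elim/tensor_piW=> a; elim/tensor_piW=> b.
by rewrite !tadd_pi; apply/tpiP; exact: presum_catC.
Qed.
Fact tadd0 : left_id (tpi [::]) tadd.
Proof. by elim/tensor_piW=> a; rewrite tadd_pi. Qed.
Fact taddN : left_inverse (tpi [::]) topp tadd.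
Proof.
elim/tensor_piW; elim=> [|[m s] l IH]; first by rewrite topp_pi tadd_pi.
rewrite -[_ :: l]cat1s -tadd_pi.
have -> : topp (tadd (tpi [:: (m, s)]) (tpi l)) =
    tadd (topp (tpi [:: (m, s)])) (topp (tpi l)).
  by rewrite !(topp_pi, tadd_pi) /presum_opp map_cat.
rewrite -taddA [tadd (topp (tpi l)) _]taddC -[tadd (tadd _ _) (topp _)]taddA.
rewrite [tadd (tpi l) _]taddC IH [tadd _ (tpi [::])]taddC tadd0.
rewrite topp_pi tadd_pi; apply/tpiP.
apply: presum_trans (presum_0 s); apply: presum_sym.
by rewrite -(addNr m); exact: presum_Dl.
Qed.
HB.instance Definition _ := GRing.isZmodule.Build tensor taddA taddC tadd0 taddN.

Lemma tpi_cat l l' : tpi (l ++ l') = tpi l + tpi l'.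
Proof. by rewrite -[RHS]/(tadd _ _) tadd_pi. Qed.
Lemma tpi_nil : tpi [::] = 0. Proof. by []. Qed.

Definition tens (m : M) (s : S) : tensor := tpi [:: (m, s)].

Lemma tpiE l : tpi l = \sum_(p <- l) tens p.1 p.2.
Proof.
elim: l => [|[m s] l IH]; first by rewrite big_nil.
by rewrite big_cons -cat1s tpi_cat IH.
Qed.

Fact tscaleA a b x : tscale a (tscale b x) = tscale (a * b) x.
Proof.
elim/tensor_piW: x => l; rewrite !tscale_pi; congr tpi.
rewrite /presum_scale -map_comp; apply: eq_map => p /=.
by rewrite mulrA.
Qed.
Fact tscale1 : left_id 1 tscale.
Proof.
elim/tensor_piW=> l; rewrite tscale_pi; congr tpi.
by rewrite /presum_scale -[RHS]map_id; apply: eq_map => -[m s] /=; rewrite mul1r.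
Qed.
Fact tscaleDr : right_distributive tscale +%R.
Proof.
move=> a; elim/tensor_piW=> l; elim/tensor_piW=> l'.
by rewrite -tpi_cat !tscale_pi /presum_scale map_cat tpi_cat.
Qed.
Fact tscaleDl x : {morph tscale^~ x : a b / a + b}.
Proof.
elim/tensor_piW: x => l a b; rewrite !tscale_pi.
elim: l => [|[m s] l IH] /=; first by rewrite tpi_nil addr0.
rewrite -cat1s -[X in _ = tpi X + _]cat1s -[X in _ = _ + tpi X]cat1s.
rewrite !tpi_cat IH addrACA; congr (_ + _).
by rewrite -tpi_cat mulrDl; apply/tpiP; exact: presum_Dr.
Qed.
HB.instance Definition _ := GRing.Zmodule_isLmodule.Build S tensor
  tscaleA tscale1 tscaleDr tscaleDl.

Lemma tensDl m m' s : tens (m + m') s = tens m s + tens m' s.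
Proof. by rewrite -tpi_cat; apply/tpiP; exact: presum_Dl. Qed.
Lemma tensDr m s s' : tens m (s + s') = tens m s + tens m s'.
Proof. by rewrite -tpi_cat; apply/tpiP; exact: presum_Dr. Qed.
Lemma tens0l s : tens 0 s = 0.
Proof. by apply/tpiP; exact: presum_0. Qed.
Lemma tens_bal r m s : tens (r *: m) s = tens m (f r * s).
Proof. by apply/tpiP; exact: presum_Z. Qed.
Lemma tens_scale a m s : a *: tens m s = tens m (a * s).
Proof. by rewrite -[LHS]/(tscale _ _) tscale_pi. Qed.

Lemma tensor_ind (P : tensor -> Prop) :
  P 0 -> (forall m s, P (tens m s)) -> (forall x y, P x -> P y -> P (x + y)) ->
  forall x, P x.
Proof.
move=> h0 ht hD; elim/tensor_piW => l; rewrite tpiE.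
elim/big_ind: _ => // p _; exact: ht.
Qed.

Section Lift.
Variable A : zmodType.

Definition balanced (b : M -> S -> A) : Prop :=
  [/\ forall m m' s, b (m + m') s = b m s + b m' s,
      forall m s s', b m (s + s') = b m s + b m s' &
      forall r m s, b (r *: m) s = b m (f r * s)].

(* Meaningful only for balanced b, see tliftE. *)
Definition tlift (b : M -> S -> A) (x : tensor) : A :=
  \sum_(p <- repr x) b p.1 p.2.

Lemma balanced_sum b l l' : balanced b -> presum_eq l l' ->
  \sum_(p <- l) b p.1 p.2 = \sum_(p <- l') b p.1 p.2.
Proof.
case=> bDl bDr bZ.
have b0 s : b 0 s = 0 by apply: (addrI (b 0 s)); rewrite -bDl !addr0.
elim=> {l l'} /=.
- by [].
- by [].
- by move=> l l' l'' _ -> _ ->.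
- by move=> l1 l1' l2 l2' _ h1 _ h2; rewrite !big_cat /= h1 h2.
- by move=> l1 l2; rewrite !big_cat /= addrC.
- by move=> s; rewrite big_seq1 big_nil b0.
- by move=> m m' s; rewrite big_seq1 big_cons big_seq1 bDl.
- by move=> m s s'; rewrite big_seq1 big_cons big_seq1 bDr.
- by move=> r m s; rewrite !big_seq1 bZ.
Qed.

Lemma tlift_pi b l : balanced b -> tlift b (tpi l) = \sum_(p <- l) b p.1 p.2.
Proof. by move=> hb; apply: (balanced_sum hb); exact: presum_repr. Qed.

Lemma tliftE b m s : balanced b -> tlift b (tens m s) = b m s.
Proof. by move=> hb; rewrite tlift_pi // big_seq1. Qed.

Lemma tliftD b x y : balanced b -> tlift b (x + y) = tlift b x + tlift b y.
Proof.
move=> hb; elim/tensor_piW: x => l; elim/tensor_piW: y => l'.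
by rewrite -tpi_cat !tlift_pi // big_cat.
Qed.
End Lift.
End Tensor.
Arguments tens {R S} f {M} m s.

Lemma tlift_linear (R S : comPzRingType) (f : {rmorphism R -> S})
    (M : lmodType R) (N : lmodType S) (b : M -> S -> N) :
  balanced f b -> (forall a m s, b m (a * s) = a *: b m s) ->
  linear (tlift b : tensor f M -> N).
Proof.
move=> hb bZ a x y; rewrite tliftD //; congr (_ + _).
elim/tensor_ind: x => [|m s|x1 x2 h1 h2].
- rewrite scaler0.
  suff -> : tlift b (0 : tensor f M) = 0 by rewrite scaler0.
  by rewrite -tpi_nil tlift_pi // big_nil.
- by rewrite tens_scale !tliftE // bZ.
- by rewrite scalerDr !tliftD // h1 h2 scalerDr.
Qed.

(* The map id (x) h : M (x)_R S -> M (x)_R S' for a homomorphism h : S -> S' of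
   R-algebras. *)
Section Push.
Variables (R S S' : comPzRingType) (f : {rmorphism R -> S}).
Variables (f' : {rmorphism R -> S'}) (h : {rmorphism S -> S'}) (M : lmodType R).

Definition tpush : tensor f M -> tensor f' M :=
  tlift (fun m s => tens f' m (h s)).

Hypothesis hf : forall r, h (f r) = f' r.

Lemma tpush_bal : balanced f (fun (m : M) s => tens f' m (h s)).
Proof.
split=> *; first by rewrite tensDl.
  by rewrite rmorphD tensDr.
by rewrite tens_bal rmorphM hf.
Qed.

Lemma tpushE m s : tpush (tens f m s) = tens f' m (h s).
Proof. exact/tliftE/tpush_bal. Qed.

Lemma tpushD x y : tpush (x + y) = tpush x + tpush y.
Proof. exact/tliftD/tpush_bal. Qed.

Lemma tpush0 : tpush 0 = 0.
Proof. by apply: (addrI (tpush 0)); rewrite -tpushD !addr0. Qed.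

Lemma tpushZ a x : tpush (a *: x) = h a *: tpush x.
Proof.
elim/tensor_ind: x => [|m s|x y hx hy].
- by rewrite !scaler0 tpush0 scaler0.
- by rewrite tens_scale !tpushE tens_scale rmorphM.
- by rewrite scalerDr !tpushD scalerDr hx hy.
Qed.
End Push.
Arguments tpush {R S S' f} f' h {M} x.

(* The map g (x) id : M (x)_R S -> N (x)_R S for a linear map g : M -> N. *)
Section Map.
Variables (R S : comPzRingType) (f : {rmorphism R -> S}) (M N : lmodType R).
Variable g : {linear M -> N}.

Definition tmap : tensor f M -> tensor f N := tlift (fun m s => tens f (g m) s).

Lemma tmap_bal : balanced f (fun (m : M) s => tens f (g m) s).
Proof.
split=> *; first by rewrite linearD tensDl.
  by rewrite tensDr.
by rewrite linearZ tens_bal.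
Qed.

Fact tmap_linear : linear tmap.
Proof.
by apply: tlift_linear tmap_bal _ => a m s; rewrite tens_scale.
Qed.
HB.instance Definition _ :=
  GRing.isLinear.Build S (tensor f M) (tensor f N) _ tmap tmap_linear.

Lemma tmapE m s : tmap (tens f m s) = tens f (g m) s.
Proof. exact/tliftE/tmap_bal. Qed.
End Map.
Arguments tmap {R S} f {M N} g x.

Definition flat (R S : comPzRingType) (f : {rmorphism R -> S}) : Prop :=
  forall (M N : lmodType R) (g : {linear M -> N}),
    injective g -> injective (tmap f g).

Definition faithfully_flat (R S : comPzRingType) (f : {rmorphism R -> S}) :
    Prop :=
  flat f /\
  forall M : lmodType R, (forall x : tensor f M, x = 0) -> forall m : M, m = 0.

Definition idR (R : comPzRingType) : {rmorphism R -> R} := idfun.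

(* The canonical isomorphism N (x)_R R -> N. *)
Section Can.
Variables (R : comPzRingType) (N : lmodType R).

Definition tcan : tensor (idR R) N -> N := tlift (fun n r => r *: n).

Lemma tcan_bal : balanced (idR R) (fun (n : N) r => r *: n).
Proof.
split=> *; first by rewrite scalerDr.
  by rewrite scalerDl.
by rewrite scalerA mulrC.
Qed.

Lemma tcanE n r : tcan (tens (idR R) n r) = r *: n.
Proof. exact/tliftE/tcan_bal. Qed.

Fact tcan_linear : linear tcan.
Proof. by apply: tlift_linear tcan_bal _ => a m s; rewrite scalerA. Qed.
HB.instance Definition _ :=
  GRing.isLinear.Build R (tensor (idR R) N) N _ tcan tcan_linear.

Lemma tcanK x : tens (idR R) (tcan x) 1 = x.
Proof.
elim/tensor_ind: x => [|m s|x y hx hy].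
- by rewrite linear0 tens0l.
- by rewrite tcanE tens_bal mulr1.
- by rewrite linearD tensDl hx hy.
Qed.
End Can.

Record polylaw (R : comPzRingType) (M N : lmodType R) := PolyLaw {
  law_at : forall (S : comPzRingType) (f : {rmorphism R -> S}),
    tensor f M -> tensor f N;
  law_natural : forall (S S' : comPzRingType) (f : {rmorphism R -> S})
      (f' : {rmorphism R -> S'}) (h : {rmorphism S -> S'}),
    (forall r, h (f r) = f' r) ->
    forall x, @law_at S' f' (tpush f' h x) = tpush f' h (@law_at S f x) }.
Arguments law_at {R M N} p {S} f x.

Definition homogeneous (R : comPzRingType) (M N : lmodType R) (d : nat)
    (p : polylaw M N) : Prop :=
  forall (S : comPzRingType) (f : {rmorphism R -> S}) (s : S) (x : tensor f M),
    law_at p f (s *: x) = s ^+ d *: law_at p f x.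

Record quadmap (R : comPzRingType) (M N : lmodType R) := QuadMap {
  quad_law :> polylaw M N;
  quad_homogeneous : homogeneous 2 quad_law }.

(* The map M -> N underlying a polynomial law, via M = M (x)_R R. *)
Definition law_val (R : comPzRingType) (M N : lmodType R) (p : polylaw M N)
    (m : M) : N :=
  tcan (law_at p (idR R) (tens (idR R) m 1)).

Definition quad_fun (R : comPzRingType) (M N : lmodType R) (Q : quadmap M N) :
    M -> N := law_val Q.
Coercion quad_fun : quadmap >-> Funclass.

Section LawVal.
Variables (R : comPzRingType) (M N : lmodType R).

Lemma law_at_tens1 (p : polylaw M N) (S : comPzRingType) (f : {rmorphism R -> S}) m :
  law_at p f (tens f m 1) = tens f (law_val p m) 1.
Proof.
have hf r : f (idR R r) = f r by [].
have -> : tens f m 1 = tpush f f (tens (idR R) m 1).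
  by rewrite tpushE // rmorph1.
rewrite (law_natural p hf) -[law_at p (idR R) _]tcanK tpushE // rmorph1.
by [].
Qed.

Lemma quadZ (Q : quadmap M N) a x : Q (a *: x) = a ^+ 2 *: Q x.
Proof.
rewrite /quad_fun /law_val.
have -> : tens (idR R) (a *: x) 1 = a *: tens (idR R) x 1.
  by rewrite tens_bal tens_scale.
by rewrite quad_homogeneous linearZ.
Qed.
End LawVal.

Definition polar (U V : zmodType) (q : U -> V) (x y : U) : V :=
  q (x + y) - q x - q y.

Lemma polarC (U V : zmodType) (q : U -> V) x y : polar q x y = polar q y x.
Proof. by rewrite /polar (addrC x y) -!addrA (addrC (- q x)). Qed.

(* A map q with q (a x) = a^2 q x and bilinear polarisation extends to a
   quadratic map by
     sum_i m_i (x) s_i  |->  sum_i q m_i (x) s_i^2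
                             + sum_{i < j} q(m_i, m_j) (x) s_i s_j. *)
Section QuadOf.
Variables (R : comPzRingType) (M N : lmodType R) (q : M -> N).
Hypothesis qZ : forall a x, q (a *: x) = a ^+ 2 *: q x.
Hypothesis qB : forall y, linear (fun x => polar q x y).

Let qBD x x' y : polar q (x + x') y = polar q x y + polar q x' y.
Proof. by have := qB y 1 x x'; rewrite !scale1r. Qed.
Let qB0 y : polar q 0 y = 0.
Proof. by apply: (addrI (polar q 0 y)); rewrite -qBD !addr0. Qed.
Let qBZ a x y : polar q (a *: x) y = a *: polar q x y.
Proof. by have := qB y a x 0; rewrite qB0 !addr0. Qed.
Let q0 : q 0 = 0.
Proof. by rewrite -(scale0r 0) qZ expr0n scale0r. Qed.
Let qD x y : q (x + y) = q x + q y + polar q x y.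
Proof. by rewrite /polar -(addrA (q (x + y))) -opprD [RHS]addrC subrK. Qed.
Let qBxx x : polar q x x = q x + q x.
Proof.
rewrite /polar -[x in q (x + _)]scale1r -[x in q (_ + x)]scale1r -scalerDl qZ.
by rewrite expr2 mulrDl mul1r !scalerDl scale1r addrA !addrK.
Qed.

Section At.
Variables (S : comPzRingType) (f : {rmorphism R -> S}).

Fixpoint qsum (l : seq (M * S)) : tensor f N :=
  if l is p :: l' then
    tens f (q p.1) (p.2 ^+ 2)
    + \sum_(p' <- l') tens f (polar q p.1 p'.1) (p.2 * p'.2)
    + qsum l'
  else 0.

Let bsum (l l' : seq (M * S)) : tensor f N :=
  \sum_(p <- l) \sum_(p' <- l') tens f (polar q p.1 p'.1) (p.2 * p'.2).

Let bsumC l l' : bsum l l' = bsum l' l.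
Proof.
rewrite /bsum exchange_big /=; apply: eq_bigr => p _; apply: eq_bigr => p' _.
by rewrite polarC mulrC.
Qed.

Let bsum_eq l1 l2 l : presum_eq f l1 l2 -> bsum l1 l = bsum l2 l.
Proof.
pose b m s := \sum_(p' <- l) tens f (polar q m p'.1) (s * p'.2).
apply: (@balanced_sum _ _ f M _ b).
split=> *; rewrite /b.
- by rewrite -big_split; apply: eq_bigr => p _; rewrite qBD tensDl.
- by rewrite -big_split; apply: eq_bigr => p _; rewrite mulrDl tensDr.
- by apply: eq_bigr => p _; rewrite qBZ tens_bal mulrA.
Qed.

Let qsum_cat l l' : qsum (l ++ l') = qsum l + qsum l' + bsum l l'.
Proof.
elim: l => [|p l IH] /=; first by rewrite /bsum big_nil add0r addr0.
rewrite IH big_cat /= /bsum big_cons.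
set A := tens _ _ _; set B := \sum_(_ <- l) _; set C := \sum_(_ <- l') _.
set D := \sum_(_ <- l) _; rewrite -!addrA; congr (_ + (_ + _)).
rewrite addrCA; congr (_ + _); rewrite addrCA; congr (_ + _).
Qed.

Lemma qsum_eq l l' : presum_eq f l l' -> qsum l = qsum l'.
Proof.
elim=> {l l'} /=.
- by [].
- by [].
- by move=> l l' l'' _ -> _ ->.
- move=> l1 l1' l2 l2' e1 h1 e2 h2; rewrite !qsum_cat h1 h2 (bsum_eq _ e1).
  by rewrite bsumC (bsum_eq _ e2) bsumC.
- by move=> l1 l2; rewrite !qsum_cat bsumC [qsum l1 + _]addrC.
- by move=> s; rewrite big_nil q0 tens0l !addr0.
- move=> m m' s; rewrite !big_cons !big_nil /= !addr0 qD !tensDl.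
  by rewrite addrAC.
- move=> m s s'; rewrite !big_cons !big_nil /= !addr0 qBxx tensDl -tensDr.
  by rewrite -!tensDr sqrrD mulr2n addrA.
- by move=> r m s; rewrite !big_nil !addr0 qZ tens_bal rmorphXn exprMn.
Qed.

Definition qext (x : tensor f M) : tensor f N := qsum (repr x).

Lemma qext_pi l : qext (tpi f l) = qsum l.
Proof. exact/qsum_eq/presum_repr. Qed.

Lemma qextZ a x : qext (a *: x) = a ^+ 2 *: qext x.
Proof.
elim/tensor_piW: x => l; rewrite -[_ *: _]/(tscale _ _) tscale_pi !qext_pi.
elim: l => [|p l IH] /=; first by rewrite scaler0.
rewrite IH !scalerDr tens_scale exprMn; congr (_ + _ + _).
rewrite scaler_sumr big_map; apply: eq_bigr => p' _.
by rewrite tens_scale expr2 mulrACA.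
Qed.
End At.

Lemma qext_natural (S S' : comPzRingType) (f : {rmorphism R -> S})
    (f' : {rmorphism R -> S'}) (h : {rmorphism S -> S'}) :
  (forall r, h (f r) = f' r) ->
  forall x : tensor f M, qext (tpush f' h x) = tpush f' h (qext x).
Proof.
move=> hf; elim/tensor_piW=> l.
have -> : tpush f' h (tpi f l) = tpi f' [seq (p.1, h p.2) | p <- l].
  rewrite !tpiE big_map; elim: l => [|p l IH]; first by rewrite !big_nil tpush0.
  by rewrite !big_cons tpushD // IH tpushE.
rewrite !qext_pi; elim: l => [|p l IH] /=; first by rewrite tpush0.
rewrite !tpushD // IH tpushE // rmorphXn; congr (_ + _ + _).
rewrite big_map; elim: l {IH} => [|p' l IH]; first by rewrite !big_nil tpush0.
by rewrite !big_cons tpushD // IH tpushE // rmorphM.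
Qed.

Definition quad_of : quadmap M N :=
  QuadMap (quad_law := PolyLaw qext_natural) qextZ.

Lemma quad_ofE m : quad_of m = q m.
Proof.
rewrite /quad_fun /law_val /= /tens qext_pi /= big_nil !addr0 tcanE.
by rewrite expr1n scale1r.
Qed.
End QuadOf.

(* (M (x)_R S) (x)_S T -> M (x)_R T and N (x)_R T -> (N (x)_R S) (x)_S T. *)
Section Tower.
Variables (R S T : comPzRingType) (f : {rmorphism R -> S}).
Variables (g : {rmorphism S -> T}) (M : lmodType R).

Definition comp_rmorph : {rmorphism R -> T} := g \o f.

Definition tcollapse : tensor g (tensor f M) -> tensor comp_rmorph M :=
  tlift (fun x t => t *: tpush comp_rmorph g x).

Definition texpand : tensor comp_rmorph M -> tensor g (tensor f M) :=
  tlift (fun m t => tens g (tens f m 1) t).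

Let gf r : g (f r) = comp_rmorph r. Proof. by []. Qed.

Lemma tcollapse_bal : balanced g
  (fun (x : tensor f M) t => t *: tpush comp_rmorph g x).
Proof.
split=> *; first by rewrite tpushD // scalerDr.
  by rewrite scalerDl.
by rewrite tpushZ // scalerA mulrC.
Qed.

Fact tcollapse_linear : linear tcollapse.
Proof. by apply: tlift_linear tcollapse_bal _ => a m s; rewrite scalerA. Qed.
HB.instance Definition _ := GRing.isLinear.Build T (tensor g (tensor f M))
  (tensor comp_rmorph M) _ tcollapse tcollapse_linear.

Lemma tcollapseE m s t :
  tcollapse (tens g (tens f m s) t) = tens comp_rmorph m (t * g s).
Proof. by rewrite /tcollapse tliftE ?tpushE ?tens_scale //; exact: tcollapse_bal. Qed.

Lemma texpand_bal : balanced comp_rmorph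
  (fun (m : M) t => tens g (tens f m 1) t).
Proof.
split=> *; first by rewrite !tensDl.
  by rewrite tensDr.
by rewrite tens_bal -tens_scale tens_bal.
Qed.

Fact texpand_linear : linear texpand.
Proof. by apply: tlift_linear texpand_bal _ => a m s; rewrite tens_scale. Qed.
HB.instance Definition _ := GRing.isLinear.Build T (tensor comp_rmorph M)
  (tensor g (tensor f M)) _ texpand texpand_linear.

Lemma texpandE m t : texpand (tens comp_rmorph m t) = tens g (tens f m 1) t.
Proof. exact/tliftE/texpand_bal. Qed.
End Tower.
Arguments tcollapse {R S T f g M}.
Arguments texpand {R S T f g M}.

Section QuadBaseChange.
Variables (R S : comPzRingType) (f : {rmorphism R -> S}) (M N : lmodType R).
Variable Q : quadmap M N.

Definition law_bc_at (T : comPzRingType) (g : {rmorphism S -> T})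
    (x : tensor g (tensor f M)) : tensor g (tensor f N) :=
  texpand (law_at Q (comp_rmorph f g) (tcollapse x)).

Fact law_bc_natural (T T' : comPzRingType) (g : {rmorphism S -> T})
    (g' : {rmorphism S -> T'}) (h : {rmorphism T -> T'}) :
  (forall s, h (g s) = g' s) ->
  forall x : tensor g (tensor f M), law_bc_at (tpush g' h x) = tpush g' h (law_bc_at x).
Proof.
move=> hg x; rewrite /law_bc_at.
have hgf r : h (comp_rmorph f g r) = comp_rmorph f g' r by exact: hg.
have -> : tcollapse (tpush g' h x) = tpush (comp_rmorph f g') h (tcollapse x).
  elim/tensor_ind: x => [|y t|x y hx hy].
  - by rewrite tpush0 // !linear0 tpush0.
  - rewrite tpushE //; elim/tensor_ind: y => [|m s|y y' hy hy'].
    + by rewrite !tens0l !linear0 tpush0.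
    + by rewrite !tcollapseE tpushE // rmorphM hg.
    + by rewrite !tensDl !linearD /= tpushD // hy hy'.
  - by rewrite tpushD // !linearD /= tpushD // hx hy.
rewrite (law_natural Q hgf); elim/tensor_ind: (law_at Q _ _) => [|m t|y z hy hz].
- by rewrite tpush0 // !linear0 tpush0.
- by rewrite tpushE // !texpandE tpushE.
- by rewrite tpushD // !linearD /= tpushD // hy hz.
Qed.

Fact law_bc_homogeneous : homogeneous 2 (PolyLaw law_bc_natural).
Proof. by move=> T g t x; rewrite /= /law_bc_at linearZ quad_homogeneous linearZ. Qed.

Definition quad_bc : quadmap (tensor f M) (tensor f N) :=
  QuadMap law_bc_homogeneous.

Lemma quad_bcE m : quad_bc (tens f m 1) = tens f (Q m) 1.
Proof.
rewrite /quad_fun {1}/law_val /= /law_bc_at tcollapseE rmorph1 mulr1.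
by rewrite law_at_tens1 texpandE tcanE scale1r.
Qed.
End QuadBaseChange.

Section QuadComp.
Variables (R : comPzRingType) (M N P : lmodType R).
Variables (Q : quadmap M N) (g : {linear N -> P}).

Fact law_comp_natural (S S' : comPzRingType) (f : {rmorphism R -> S})
    (f' : {rmorphism R -> S'}) (h : {rmorphism S -> S'}) :
  (forall r, h (f r) = f' r) -> forall x : tensor f M,
  tmap f' g (law_at Q f' (tpush f' h x)) = tpush f' h (tmap f g (law_at Q f x)).
Proof.
move=> hf x; rewrite (law_natural Q hf).
elim/tensor_ind: (law_at Q f x) => [|m t|y z hy hz].
- by rewrite tpush0 // !linear0 tpush0.
- by rewrite tpushE // !tmapE tpushE.
- by rewrite tpushD // !linearD /= tpushD // hy hz.
Qed.

Fact law_comp_homogeneous : homogeneous 2 (PolyLaw law_comp_natural).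
Proof. by move=> S f s x; rewrite /= quad_homogeneous linearZ. Qed.

Definition quad_comp : quadmap M P := QuadMap law_comp_homogeneous.

Lemma quad_compE m : quad_comp m = g (Q m).
Proof.
by rewrite /quad_fun /law_val /= law_at_tens1 tmapE !tcanE !scale1r.
Qed.
End QuadComp.

Lemma linear_funext (R : pzRingType) (M N : lmodType R) (g h : {linear M -> N}) :
  g =1 h -> g = h.
Proof.
case: g => g [[ga] [gs]]; case: h => h [[ha] [hs]] /= gh.
have e : g = h by exact/funext.
move: ha hs; case: h / e {gh} => ha hs.
by rewrite (Prop_irrelevance ga ha) (Prop_irrelevance gs hs).
Qed.

Notation endo M := {linear M -> M}.

Section Endo.
Variables (R : comPzRingType) (M : lmodType R).
Local Notation E := (endo M).

HB.instance Definition _ := gen_eqMixin E.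
HB.instance Definition _ := gen_choiceMixin E.

Lemma endoP (g h : E) : g =1 h -> g = h.
Proof. exact: linear_funext. Qed.

Definition mk_endo (g : M -> M) (hg : linear g) : E :=
  HB.pack_for {linear M -> M} g (GRing.isLinear.Build R M M _ g hg).

Fact eadd_lin (g h : E) : linear (fun x => g x + h x).
Proof. by move=> a x y; rewrite !linearP scalerDr addrACA. Qed.
Fact eopp_lin (g : E) : linear (fun x => - g x).
Proof. by move=> a x y; rewrite linearP opprD scalerN. Qed.
Fact ezero_lin : linear (fun _ : M => 0 : M).
Proof. by move=> a x y; rewrite scaler0 addr0. Qed.
Fact escale_lin (a : R) (g : E) : linear (fun x => a *: g x).
Proof. by move=> b x y; rewrite linearP scalerDr !scalerA mulrC. Qed.

Definition eadd g h : E := mk_endo (eadd_lin g h).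
Definition eopp g : E := mk_endo (eopp_lin g).
Definition ezero : E := mk_endo ezero_lin.
Definition escale a g : E := mk_endo (escale_lin a g).

Fact eaddA : associative eadd.
Proof. by move=> g h k; apply: endoP => x; exact: addrA. Qed.
Fact eaddC : commutative eadd.
Proof. by move=> g h; apply: endoP => x; exact: addrC. Qed.
Fact eadd0 : left_id ezero eadd.
Proof. by move=> g; apply: endoP => x; exact: add0r. Qed.
Fact eaddN : left_inverse ezero eopp eadd.
Proof. by move=> g; apply: endoP => x; exact: addNr. Qed.
HB.instance Definition _ := GRing.isZmodule.Build E eaddA eaddC eadd0 eaddN.

Fact escaleA a b g : escale a (escale b g) = escale (a * b) g.
Proof. by apply: endoP => x; exact: scalerA. Qed.
Fact escale1 : left_id 1 escale.
Proof. by move=> g; apply: endoP => x; exact: scale1r. Qed.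
Fact escaleDr : right_distributive escale +%R.
Proof. by move=> a g h; apply: endoP => x; exact: scalerDr. Qed.
Fact escaleDl g : {morph escale^~ g : a b / a + b}.
Proof. by move=> a b; apply: endoP => x; exact: scalerDl. Qed.
HB.instance Definition _ := GRing.Zmodule_isLmodule.Build R E
  escaleA escale1 escaleDr escaleDl.

Lemma endoDE (g h : E) x : (g + h : E) x = g x + h x. Proof. by []. Qed.
Lemma endoNE (g : E) x : (- g : E) x = - g x. Proof. by []. Qed.
Lemma endoZE a (g : E) x : (a *: g : E) x = a *: g x. Proof. by []. Qed.
End Endo.

(* The canonical map End_R(M) (x)_R S -> End_S(M (x)_R S),
   phi (x) s |-> s (phi (x) id). *)
Section EndoBaseChange.
Variables (R S : comPzRingType) (f : {rmorphism R -> S}) (M : lmodType R).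

Definition endo_tmap (phi : endo M) : endo (tensor f M) :=
  mk_endo (@tmap_linear R S f M M phi).

Lemma endo_tmapE (phi : endo M) x : endo_tmap phi x = tmap f phi x.
Proof. by []. Qed.

Definition endo_bc : tensor f (endo M) -> endo (tensor f M) :=
  tlift (fun (phi : endo M) s => s *: endo_tmap phi).

Lemma endo_bc_bal : balanced f
  (fun (phi : endo M) s => s *: endo_tmap phi).
Proof.
split=> [phi psi s|phi s s'|r phi s]; last 1 first.
- apply: endoP => x; rewrite !endoZE !endo_tmapE.
  elim/tensor_ind: x => [|m t|x y hx hy]; first by rewrite !linear0 ?scaler0.
    by rewrite !tmapE -[tens f _ t]/(tens f (r *: phi m) t) tens_bal !tens_scale mulrA [s * f r]mulrC.
  by rewrite !linearD /= ?scalerDr hx hy.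
- apply: endoP => x; rewrite !(endoZE, endoDE, endo_tmapE) -scalerDr; congr (_ *: _).
  elim/tensor_ind: x => [|m t|x y hx hy]; first by rewrite !linear0 addr0.
    by rewrite !tmapE -[tens f _ t]/(tens f (phi m + psi m) t) tensDl.
  by rewrite !linearD /= hx hy addrACA.
- by rewrite scalerDl.
Qed.

Fact endo_bc_linear : linear endo_bc.
Proof. by apply: tlift_linear endo_bc_bal _ => a m s; rewrite scalerA. Qed.
HB.instance Definition _ := GRing.isLinear.Build S (tensor f (endo M))
  (endo (tensor f M)) _ endo_bc endo_bc_linear.

Lemma endo_bcE phi s m t :
  endo_bc (tens f phi s) (tens f m t) = tens f (phi m) (s * t).
Proof.
by rewrite /endo_bc tliftE ?endoZE ?endo_tmapE ?tmapE ?tens_scale //; exact: endo_bc_bal.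
Qed.
End EndoBaseChange.

Record paraquad (R : comPzRingType) := ParaQuad {
  pq_mod :> lmodType R;
  pq_quad : quadmap pq_mod (endo pq_mod);
  pq_one : pq_mod;
  pq_quad1 : forall y, pq_quad pq_one y = y }.

Definition pq_U (R : comPzRingType) (J : paraquad R) (x y : J) : J :=
  pq_quad J x y.

Definition pq_triple (R : comPzRingType) (J : paraquad R) (x y z : J) : J :=
  pq_U (x + z) y - pq_U x y - pq_U z y.

Definition pq_isom (R : comPzRingType) (J J' : paraquad R) : Prop :=
  exists phi : {linear J -> J'},
    [/\ bijective phi, phi (pq_one J) = pq_one J' &
        forall x y, phi (pq_U x y) = pq_U (phi x) (phi y)].

Section ParaQuadBaseChange.
Variables (R S : comPzRingType) (f : {rmorphism R -> S}) (J : paraquad R).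

Definition pq_bc_quad : quadmap (tensor f J) (endo (tensor f J)) :=
  quad_comp (quad_bc f (pq_quad J)) (@endo_bc R S f J).

Lemma pq_bc_quadE x y t :
  pq_bc_quad (tens f x 1) (tens f y t) = tens f (pq_U x y) t.
Proof. by rewrite quad_compE quad_bcE endo_bcE mul1r. Qed.

Fact pq_bc_quad1 y : pq_bc_quad (tens f (pq_one J) 1) y = y.
Proof.
elim/tensor_ind: y => [|m s|x y hx hy]; first by rewrite linear0.
  by rewrite pq_bc_quadE /pq_U pq_quad1.
by rewrite linearD hx hy.
Qed.

Definition pq_bc : paraquad S := ParaQuad pq_bc_quad1.
End ParaQuadBaseChange.

Definition fin_gen (R : comPzRingType) (M : lmodType R) : Prop :=
  exists (n : nat) (e : 'I_n -> M),
    forall x, exists a : 'I_n -> R, x = \sum_i a i *: e i.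

Definition projective (R : comPzRingType) (P : lmodType R) : Prop :=
  forall (M N : lmodType R) (p : {linear M -> N}) (g : {linear P -> N}),
    (forall y, exists x, p x = y) ->
    exists h : {linear P -> M}, forall x, p (h x) = g x.

(* A unital nonassociative algebra together with a scalar-valued function. *)
Record formalg (R : comPzRingType) := FormAlg {
  fa_mod :> lmodType R;
  fa_mul : fa_mod -> fa_mod -> fa_mod;
  fa_one : fa_mod;
  fa_norm : fa_mod -> R }.

Record compalg (R : comPzRingType) := CompAlg {
  ca_mod :> lmodType R;
  ca_mul : ca_mod -> ca_mod -> ca_mod;
  ca_one : ca_mod;
  ca_norm : quadmap ca_mod R^o;
  ca_mul_linl : forall y, linear (fun x => ca_mul x y);
  ca_mul_linr : forall x, linear (ca_mul x);
  ca_mul1l : left_id ca_one ca_mul;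
  ca_mul1r : right_id ca_one ca_mul;
  ca_fin_gen : fin_gen ca_mod;
  ca_projective : projective ca_mod;
  ca_norm_mul : forall x y,
    ca_norm (ca_mul x y) = (ca_norm x : R) * (ca_norm y : R);
  ca_norm_one : ca_norm ca_one = (1 : R);
  ca_polar_lin : forall x, linear (fun y => polar ca_norm x y);
  ca_polar_bij : forall l : {linear ca_mod -> R^o},
    exists! x, forall y, polar ca_norm x y = l y }.

Definition formalg_of (R : comPzRingType) (C : compalg R) : formalg R :=
  FormAlg (@ca_mul R C) (ca_one C) (@ca_norm R C).

Definition ca_polar (R : comPzRingType) (C : compalg R) (x y : C) : R :=
  polar (ca_norm C) x y.
Definition ca_tr (R : comPzRingType) (C : compalg R) (x : C) : R :=
  ca_polar x (ca_one C).
Definition ca_conj (R : comPzRingType) (C : compalg R) (x : C) : C :=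
  ca_tr x *: ca_one C - x.

(* Homomorphisms over a change of base ring phi : R -> R'. *)
Definition fa_hom (R R' : comPzRingType) (phi : {rmorphism R -> R'})
    (A : formalg R) (A' : formalg R') (psi : A -> A') : Prop :=
  [/\ forall a x y, psi (a *: x + y) = phi a *: psi x + psi y,
      psi (fa_one A) = fa_one A',
      forall x y, psi (fa_mul x y) = fa_mul (psi x) (psi y) &
      forall x, phi (fa_norm x) = fa_norm (psi x)].

Section Split.
Variable R : comPzRingType.

Definition fa_rank1 : formalg R :=
  @FormAlg R R^o (fun x y => (x : R) * (y : R)) (1 : R) (fun x => (x : R) ^+ 2).

Definition fa_rank2 : formalg R :=
  @FormAlg R (R^o * R^o)%type
    (fun x y => ((x.1 : R) * (y.1 : R), (x.2 : R) * (y.2 : R)))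
    (1 : R, 1 : R) (fun x => (x.1 : R) * (x.2 : R)).

Definition fa_mat2 : formalg R :=
  @FormAlg R 'M[R]_2 (fun x y => x *m y) 1%:M (fun x => \det x).

Definition dot (u v : 'cV[R]_3) : R := (u^T *m v) 0 0.

Definition cross (u v : 'cV[R]_3) : 'cV[R]_3 :=
  \col_i (u (i + 1) 0 * v (i + 2%:R) 0 - u (i + 2%:R) 0 * v (i + 1) 0).

Record zor := Zor {
  zor_a1 : R; zor_u : 'cV[R]_3; zor_x : 'cV[R]_3; zor_a2 : R }.

Definition zor_tuple (z : zor) : R^o * 'cV[R]_3 * 'cV[R]_3 * R^o :=
  (zor_a1 z, zor_u z, zor_x z, zor_a2 z).
Definition tuple_zor (t : R^o * 'cV[R]_3 * 'cV[R]_3 * R^o) : zor :=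
  Zor t.1.1.1 t.1.1.2 t.1.2 t.2.

HB.instance Definition _ := gen_eqMixin zor.
HB.instance Definition _ := gen_choiceMixin zor.

Definition zor_add (z w : zor) : zor := tuple_zor (zor_tuple z + zor_tuple w).
Definition zor_opp (z : zor) : zor := tuple_zor (- zor_tuple z).
Definition zor_zero : zor := tuple_zor 0.
Definition zor_scale (a : R) (z : zor) : zor := tuple_zor (a *: zor_tuple z).

Fact zor_tupleK : cancel zor_tuple tuple_zor.
Proof. by case. Qed.
Fact tuple_zorK : cancel tuple_zor zor_tuple.
Proof. by case=> [[[? ?] ?] ?]. Qed.

Fact zor_addA : associative zor_add.
Proof. by move=> z w t; rewrite /zor_add !tuple_zorK addrA. Qed.
Fact zor_addC : commutative zor_add.
Proof. by move=> z w; rewrite /zor_add addrC. Qed.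
Fact zor_add0 : left_id zor_zero zor_add.
Proof. by move=> z; rewrite /zor_add tuple_zorK add0r zor_tupleK. Qed.
Fact zor_addN : left_inverse zor_zero zor_opp zor_add.
Proof. by move=> z; rewrite /zor_add tuple_zorK addNr. Qed.
HB.instance Definition _ :=
  GRing.isZmodule.Build zor zor_addA zor_addC zor_add0 zor_addN.

Fact zor_scaleA a b z : zor_scale a (zor_scale b z) = zor_scale (a * b) z.
Proof. by rewrite /zor_scale tuple_zorK scalerA. Qed.
Fact zor_scale1 : left_id 1 zor_scale.
Proof. by move=> z; rewrite /zor_scale scale1r zor_tupleK. Qed.
Fact zor_scaleDr : right_distributive zor_scale +%R.
Proof.
move=> a z w; rewrite -[RHS]/(zor_add _ _) -[z + w]/(zor_add _ _).
by rewrite /zor_add /zor_scale !tuple_zorK scalerDr.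
Qed.
Fact zor_scaleDl z : {morph zor_scale^~ z : a b / a + b}.
Proof.
move=> a b; rewrite -[RHS]/(zor_add _ _).
by rewrite /zor_add /zor_scale !tuple_zorK scalerDl.
Qed.
HB.instance Definition _ := GRing.Zmodule_isLmodule.Build R zor
  zor_scaleA zor_scale1 zor_scaleDr zor_scaleDl.

Definition zor_mul (z w : zor) : zor :=
  let: Zor a1 u x a2 := z in
  let: Zor b1 v y b2 := w in
  Zor (a1 * b1 - dot u y)
      (a1 *: v + b2 *: u + cross x y)
      (b1 *: x + a2 *: y + cross u v)
      (- dot x v + a2 * b2).

Definition fa_zor : formalg R :=
  @FormAlg R zor zor_mul (Zor 1 0 0 1)
    (fun z => zor_a1 z * zor_a2 z + dot (zor_u z) (zor_x z)).
End Split.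

(* The maps phi_e identify R with the product of the R_e, and the maps psi_e
   identify C with the product of the split composition R_e-algebras. *)
Definition split_compalg (R : comPzRingType) (C : compalg R) : Prop :=
  exists (R0 R1 R2 R3 : comPzRingType)
    (phi0 : {rmorphism R -> R0}) (phi1 : {rmorphism R -> R1})
    (phi2 : {rmorphism R -> R2}) (phi3 : {rmorphism R -> R3})
    (psi0 : C -> fa_rank1 R0) (psi1 : C -> fa_rank2 R1)
    (psi2 : C -> fa_mat2 R2) (psi3 : C -> fa_zor R3),
    [/\ bijective (fun r => (phi0 r, phi1 r, phi2 r, phi3 r)),
        bijective (fun c => (psi0 c, psi1 c, psi2 c, psi3 c)),
        exists h : R0, 2%:R * h = 1 &
        [/\ fa_hom phi0 (A := formalg_of C) psi0,
            fa_hom phi1 (A := formalg_of C) psi1,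
            fa_hom phi2 (A := formalg_of C) psi2 &
            fa_hom phi3 (A := formalg_of C) psi3]].

(* The matrix with rows (a_1, c_3, conj c_2), (conj c_3, a_2, c_1),
   (c_2, conj c_1, a_3) is given by its coordinates (a_i), (c_i).  The indices
   are taken modulo 3, so that the index 3 of the matrix is 0 : 'I_3. *)
Definition quadratic (R : comPzRingType) (M N : lmodType R) (q : M -> N) :
    Prop :=
  (forall a x, q (a *: x) = a ^+ 2 *: q x) /\
  (forall y, linear (fun x => polar q x y)).

Section Quadratic.
Variables (R : comPzRingType) (M N P : lmodType R).

Lemma quadratic_bilin (b : M -> M -> N) :
  (forall y, linear (fun x => b x y)) -> (forall x, linear (b x)) ->
  quadratic (fun x => b x x).
Proof.
move=> bl br.
have b0l y : b 0 y = 0.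
  by have := bl y 1 0 0; rewrite scaler0 addr0 scale1r -[LHS]addr0 => /addrI.
have b0r x : b x 0 = 0.
  by have := br x 1 0 0; rewrite scaler0 addr0 scale1r -[LHS]addr0 => /addrI.
have bZl a x y : b (a *: x) y = a *: b x y.
  by have := bl y a x 0; rewrite b0l !addr0.
have bZr a x y : b x (a *: y) = a *: b x y.
  by have := br x a y 0; rewrite b0r !addr0.
have bDl x x' y : b (x + x') y = b x y + b x' y.
  by have := bl y 1 x x'; rewrite !scale1r.
have bDr x y y' : b x (y + y') = b x y + b x y'.
  by have := br x 1 y y'; rewrite !scale1r.
have bpol x y : polar (fun x => b x x) x y = b x y + b y x.
  rewrite /polar bDl !bDr.
  move: (b x x) (b x y) (b y x) (b y y) => s t u v.
  by rewrite -(addrA s) [s + _]addrC addrK addrA addrK.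
split=> [a x|y a x x']; first by rewrite bZl bZr scalerA expr2.
by rewrite !bpol bl br scalerDr addrACA.
Qed.

Lemma quadratic_add (q q' : M -> N) :
  quadratic q -> quadratic q' -> quadratic (fun x => q x + q' x).
Proof.
case=> qZ qB [qZ' qB']; split=> [a x|y a x x']; first by rewrite qZ qZ' scalerDr.
have pD z : polar (fun x => q x + q' x) z y = polar q z y + polar q' z y.
  by rewrite /polar !opprD [RHS]addrACA; congr (_ + _); rewrite addrACA.
by rewrite !pD qB qB' addrACA -scalerDr.
Qed.

Lemma quadratic_linl (g : N -> P) (q : M -> N) :
  linear g -> quadratic q -> quadratic (fun x => g (q x)).
Proof.
move=> gl [qZ qB].
have g0 : g 0 = 0.
  by have := gl 1 0 0; rewrite scaler0 addr0 scale1r -[LHS]addr0 => /addrI.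
have gD x y : g (x + y) = g x + g y by have := gl 1 x y; rewrite !scale1r.
have gN x : g (- x) = - g x by apply: (addrI (g x)); rewrite -gD !subrr.
split=> [a x|y a x x'].
  by have := gl (a ^+ 2) (q x) 0; rewrite -qZ g0 !addr0.
have gp z : polar (fun x => g (q x)) z y = g (polar q z y).
  by rewrite /polar !gD !gN.
by rewrite !gp qB gl.
Qed.

Lemma quadratic_linr (g : P -> M) (q : M -> N) :
  linear g -> quadratic q -> quadratic (fun x => q (g x)).
Proof.
move=> gl [qZ qB].
have g0 : g 0 = 0.
  by have := gl 1 0 0; rewrite scaler0 addr0 scale1r -[LHS]addr0 => /addrI.
have gD x y : g (x + y) = g x + g y by have := gl 1 x y; rewrite !scale1r.
split=> [a x|y a x x'].
  by have := gl a x 0; rewrite g0 !addr0 => ->.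
have gp z : polar (fun x => q (g x)) z y = polar q (g z) (g y).
  by rewrite /polar gD.
by rewrite !gp gl qB.
Qed.
End Quadratic.

Section Her3.
Variables (R : comPzRingType) (C : compalg R).
Local Notation n := (ca_norm C).
Local Notation mul := (@ca_mul R C).
Local Notation conj := (@ca_conj R C).

Definition her3_mod : lmodType R :=
  ({ffun 'I_3 -> R^o} * {ffun 'I_3 -> C})%type.
Local Notation H := her3_mod.

Definition hdiag (x : H) (i : 'I_3) : R := x.1 i.
Definition hoff (x : H) (i : 'I_3) : C := x.2 i.
Definition mk_her3 (a : 'I_3 -> R) (c : 'I_3 -> C) : H :=
  ([ffun i => a i : R^o], [ffun i => c i]).

Definition her3_one : H := mk_her3 (fun _ => 1) (fun _ => 0).

Definition her3_T (x y : H) : R :=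
  \sum_i (hdiag x i * hdiag y i + ca_polar (hoff x i) (hoff y i)).

Definition her3_sharp (x : H) : H :=
  mk_her3
    (fun i => hdiag x (i + 1) * hdiag x (i + 2%:R) - n (hoff x i))
    (fun i => - (hdiag x i *: hoff x i)
              + conj (mul (hoff x (i + 1)) (hoff x (i + 2%:R)))).

Definition her3_cross (x y : H) : H := polar her3_sharp x y.

Definition her3_U (x y : H) : H :=
  her3_T x y *: x - her3_cross (her3_sharp x) y.

Let her3P (x y : H) :
  (forall i, hdiag x i = hdiag y i) -> (forall i, hoff x i = hoff y i) -> x = y.
Proof.
case: x y => [a c] [b d] /= h1 h2; congr (_, _); apply/ffunP => i.
  exact: h1.
exact: h2.
Qed.

Let hdiagP a x y i : hdiag (a *: x + y) i = a * hdiag x i + hdiag y i.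
Proof. by rewrite /hdiag /= !ffunE. Qed.
Let hoffP a x y i : hoff (a *: x + y) i = a *: hoff x i + hoff y i.
Proof. by rewrite /hoff /= !ffunE. Qed.
Let hdiagD x y i : hdiag (x + y) i = hdiag x i + hdiag y i.
Proof. by rewrite /hdiag /= !ffunE. Qed.
Let hoffD x y i : hoff (x + y) i = hoff x i + hoff y i.
Proof. by rewrite /hoff /= !ffunE. Qed.
Let hdiagN x i : hdiag (- x) i = - hdiag x i.
Proof. by rewrite /hdiag /= !ffunE. Qed.
Let hoffN x i : hoff (- x) i = - hoff x i.
Proof. by rewrite /hoff /= !ffunE. Qed.
Let hdiagZ a x i : hdiag (a *: x) i = a * hdiag x i.
Proof. by rewrite /hdiag /= !ffunE. Qed.
Let hoffZ a x i : hoff (a *: x) i = a *: hoff x i.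
Proof. by rewrite /hoff /= !ffunE. Qed.
Let hdiag_mk a c i : hdiag (mk_her3 a c) i = a i.
Proof. by rewrite /hdiag /= ffunE. Qed.
Let hoff_mk a c i : hoff (mk_her3 a c) i = c i.
Proof. by rewrite /hoff /= ffunE. Qed.
Let hE := (hdiagD, hoffD, hdiagN, hoffN, hdiagZ, hoffZ, hdiag_mk, hoff_mk).

Let polarP (x y z : C) a :
  ca_polar z (a *: x + y) = a * ca_polar z x + ca_polar z y.
Proof. exact: ca_polar_lin. Qed.
Let polC (x y : C) : ca_polar x y = ca_polar y x.
Proof. exact: polarC. Qed.
Let polarPl (x y z : C) a :
  ca_polar (a *: x + y) z = a * ca_polar x z + ca_polar y z.
Proof. by rewrite polC polarP !(polC z). Qed.
Let conjP a (x y : C) : conj (a *: x + y) = a *: conj x + conj y.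
Proof.
by rewrite /ca_conj /ca_tr polarPl scalerDl scalerBr scalerA opprD addrACA.
Qed.
Let mulPl a x y z : mul (a *: x + y) z = a *: mul x z + mul y z.
Proof. exact: ca_mul_linl. Qed.
Let mulPr a x y z : mul z (a *: x + y) = a *: mul z x + mul z y.
Proof. exact: ca_mul_linr. Qed.
Let polar0 (x : C) : ca_polar x 0 = 0.
Proof.
by have := polarP 0 0 x 1; rewrite scaler0 addr0 mul1r -[LHS]addr0 => /addrI.
Qed.
Let mul0l x : mul 0 x = 0.
Proof.
by have := mulPl 1 0 0 x; rewrite scaler0 addr0 scale1r -[LHS]addr0 => /addrI.
Qed.
Let mul0r x : mul x 0 = 0.
Proof.
by have := mulPr 1 0 0 x; rewrite scaler0 addr0 scale1r -[LHS]addr0 => /addrI.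
Qed.
Let conj0 : conj 0 = 0.
Proof.
by have := conjP 1 0 0; rewrite scaler0 addr0 scale1r -[LHS]addr0 => /addrI.
Qed.
Let mulDl x y z : mul (x + y) z = mul x z + mul y z.
Proof. by have := mulPl 1 x y z; rewrite !scale1r. Qed.
Let mulDr x y z : mul z (x + y) = mul z x + mul z y.
Proof. by have := mulPr 1 x y z; rewrite !scale1r. Qed.
Let mulZl a x z : mul (a *: x) z = a *: mul x z.
Proof. by have := mulPl a x 0 z; rewrite mul0l !addr0. Qed.
Let mulZr a x z : mul z (a *: x) = a *: mul z x.
Proof. by have := mulPr a x 0 z; rewrite mul0r !addr0. Qed.
Let conjD x y : conj (x + y) = conj x + conj y.
Proof. by have := conjP 1 x y; rewrite !scale1r. Qed.
Let conjZ a x : conj (a *: x) = a *: conj x.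
Proof. by have := conjP a x 0; rewrite conj0 !addr0. Qed.
Let nD (x y : C) : (n (x + y) : R) = n x + n y + ca_polar x y.
Proof. by rewrite /ca_polar /polar -(addrA (n (x + y))) -opprD [RHS]addrC subrK. Qed.

Let mk_her3_quad (a : H -> 'I_3 -> R^o) (c : H -> 'I_3 -> C) :
  (forall i, quadratic (fun x => a x i)) ->
  (forall i, quadratic (fun x => c x i)) ->
  quadratic (fun x => mk_her3 (a x) (c x)).
Proof.
move=> ha hc; split=> [t x|y t x x']; apply: her3P => i; rewrite /polar !hE.
- exact: (ha i).1.
- exact: (hc i).1.
- exact: (ha i).2.
- exact: (hc i).2.
Qed.

Let conj_lin : linear conj.
Proof. by move=> a x y; exact: conjP. Qed.

Lemma her3_sharp_quad : quadratic her3_sharp.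
Proof.
apply: mk_her3_quad => i.
- apply: quadratic_add.
    apply: (@quadratic_bilin _ _ _ (fun x y : H =>
      hdiag x (i + 1) * hdiag y (i + 2%:R) : R^o)).
      by move=> y a x x'; rewrite hdiagP mulrDl -mulrA.
    by move=> x a y y'; rewrite hdiagP mulrDr mulrCA.
  apply: (@quadratic_linl _ _ _ _ (fun t : R^o => - t)).
    by move=> a x y; rewrite opprD scalerN.
  apply: (@quadratic_linr _ _ _ _ (fun x : H => hoff x i)).
    by move=> a x y; rewrite hoffP.
  split=> [a x|y a x x']; first exact: quadZ.
  by rewrite !(polarC _ _ y); exact: ca_polar_lin.
- apply: quadratic_add.
    apply: (@quadratic_linl _ _ _ _ (fun t : C => - t)).
      by move=> a x y; rewrite opprD scalerN.
    apply: (@quadratic_bilin _ _ _ (fun x y : H => hdiag x i *: hoff y i)).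
      by move=> y a x x'; rewrite hdiagP scalerDl scalerA.
    by move=> x a y y'; rewrite hoffP scalerDr !scalerA mulrC.
  apply: (@quadratic_linl _ _ _ _ _ _ conj_lin).
  apply: (@quadratic_bilin _ _ _ (fun x y : H =>
    mul (hoff x (i + 1)) (hoff y (i + 2%:R)))).
    by move=> y a x x'; rewrite hoffP mulPl.
  by move=> x a y y'; rewrite hoffP mulPr.
Qed.

Let cross_linl y : linear (fun x => her3_cross x y).
Proof. exact: her3_sharp_quad.2. Qed.
Let cross_linr x : linear (her3_cross x).
Proof.
by move=> a y y'; rewrite /her3_cross !(polarC _ x); exact: cross_linl.
Qed.

Let T_linl a x x' y : her3_T (a *: x + x') y = a * her3_T x y + her3_T x' y.
Proof.
rewrite /her3_T mulr_sumr -big_split /=; apply: eq_bigr => i _.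
by rewrite hdiagP hoffP polarPl; ring.
Qed.
Let T_linr a x y y' : her3_T x (a *: y + y') = a * her3_T x y + her3_T x y'.
Proof.
rewrite /her3_T mulr_sumr -big_split /=; apply: eq_bigr => i _.
by rewrite hdiagP hoffP polarP; ring.
Qed.

Fact her3_U_linear x : linear (her3_U x).
Proof.
move=> a y y'; rewrite /her3_U T_linr cross_linr scalerDl -scalerA.
by rewrite opprD addrACA -scalerBr.
Qed.

Definition her3_U_endo (x : H) : endo H := mk_endo (her3_U_linear x).

Let her3_U_quad y : quadratic (fun x => her3_U x y).
Proof.
apply: quadratic_add.
  apply: (@quadratic_bilin _ _ _ (fun x z : H => her3_T x y *: z)).
    by move=> z a x x'; rewrite T_linl scalerDl scalerA.
  by move=> x a z z'; rewrite scalerDr !scalerA mulrC.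
apply: (@quadratic_linl _ _ _ _ (fun t : H => - her3_cross t y)).
  by move=> a x x'; rewrite cross_linl opprD scalerN.
exact: her3_sharp_quad.
Qed.

Fact her3_U_endoZ a x : her3_U_endo (a *: x) = a ^+ 2 *: her3_U_endo x.
Proof. by apply: endoP => y; exact: (her3_U_quad y).1. Qed.

Fact her3_U_endoB y : linear (fun x => polar her3_U_endo x y).
Proof. by move=> a x x'; apply: endoP => z; exact: (her3_U_quad z).2. Qed.

Definition her3_quad : quadmap H (endo H) := quad_of her3_U_endoZ her3_U_endoB.

Fact her3_quad1 y : her3_quad her3_one y = y.
Proof.
rewrite quad_ofE -[LHS]/(her3_U her3_one y) /her3_U.
have n0 : (n 0 : R) = 0 by rewrite -(scale0r 0) quadZ expr0n scale0r.
have p0 c : ca_polar (0 : C) c = 0 by rewrite polC polar0.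
have -> : her3_sharp her3_one = her3_one.
  apply: her3P => i; rewrite !hE.
    by rewrite n0 subr0 mul1r.
  by rewrite mul0l conj0 scaler0 oppr0 addr0.
have -> : her3_T her3_one y = \sum_i hdiag y i.
  by apply: eq_bigr => i _; rewrite !hE p0 addr0 mul1r.
apply: her3P => i; rewrite /her3_cross /polar !hE.
  rewrite nD n0 p0; suff -> : \sum_j hdiag y j =
      hdiag y i + hdiag y (i + 1) + hdiag y (i + 2%:R) by ring.
  rewrite !big_ord_recl big_ord0 addr0.
  have E (j k : 'I_3) : val j = val k -> hdiag y j = hdiag y k.
    by move/val_inj->.
  case: i => [[|[|[|//]]] hi]; rewrite -!addrA.
  - by congr (_ + (_ + _)); exact: E.
  - rewrite [LHS]addrC -addrA.
    by congr (_ + (_ + _)); exact: E.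
  - rewrite [LHS]addrA [LHS]addrC.
    by congr (_ + (_ + _)); exact: E.
rewrite !add0r !scaler0 mul0l conj0 oppr0 addr0 subr0 add0r opprB.
by rewrite scalerDl scale1r opprD opprK addrACA subrr addr0 addrC addrK.
Qed.

Definition her3 : paraquad R := ParaQuad her3_quad1.

Lemma her3_pqU (x y : her3) : pq_U x y = her3_U x y.
Proof. by rewrite /pq_U /= quad_ofE. Qed.
End Her3.

Definition split_freudenthal (R : comPzRingType) (J : paraquad R) : Prop :=
  exists2 C : compalg R, split_compalg C & J = her3 C.

Definition freudenthal (R : comPzRingType) (J : paraquad R) : Prop :=
  exists (S : comPzRingType) (f : {rmorphism R -> S}) (J' : paraquad S),
    [/\ faithfully_flat f, split_freudenthal J' & pq_isom (pq_bc f J) J'].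

Local Open Scope classical_set_scope.

Section Span.
Variables (R : comPzRingType) (M : lmodType R).

Definition submodule (I : set M) : Prop :=
  I 0 /\ forall a x y, I x -> I y -> I (a *: x + y).

Definition lin_span (A : set M) : set M :=
  [set x | exists (k : nat) (a : 'I_k -> R) (m : 'I_k -> M),
     (forall i, A (m i)) /\ x = \sum_i a i *: m i].

Definition set_add (A B : set M) : set M := [set x + y | x in A & y in B].
End Span.

Section Ideals.
Variables (R : comPzRingType) (J : paraquad R).

Definition U_span (A B : set J) : set J :=
  lin_span [set pq_U a b | a in A & b in B].

Definition JJ_span (I : set J) : set J :=
  lin_span [set w | exists x y z, I z /\ w = pq_triple x y z].

Definition pq_ideal (I : set J) : Prop :=
  submodule I /\
  set_add (set_add (U_span I setT) (U_span setT I)) (JJ_span I) = I.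

Definition pq_outer_ideal (I : set J) : Prop :=
  submodule I /\ set_add (U_span setT I) (JJ_span I) = I.

Definition ring_ideal (a : set R) : Prop := submodule (M := R^o) a.

(* The intersection of I with R 1_J, as a subset of R. *)
Definition contraction (I : set J) : set R := [set r | I (r *: pq_one J)].

Definition extension (a : set R) : set J :=
  lin_span [set r *: x | r in a & x in [set: J]].
End Ideals.
Arguments pq_outer_ideal {R} J.
Arguments ring_ideal R : clear implicits.

(* Main.v *)
Require Import Defs.
From HB Require Import structures.
From mathcomp Require Import all_boot all_order all_algebra.
From mathcomp Require Import ring.
From mathcomp Require Import boolp classical_sets functions.

Set Implicit Arguments.
Unset Strict Implicit.
Unset Printing Implicit Defensive.

Import GRing.Theory.
Local Open Scope ring_scope.
Local Open Scope quotient_scope.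
Local Open Scope classical_set_scope.

(** For the hermitian matrices Her_3(C) over a composition S-algebra C, every
    submodule K stable under all operators U_x is bH, where H is the whole
    algebra and b is the set of scalars s with s 1 in K.  Write e_i for the
    diagonal units and d[l] for the matrix with off-diagonal coordinate d in
    position l.  Then U_{e_i} k is the i-th diagonal coordinate of k times e_i,
    and U_{1[l]} exchanges the two diagonal units other than e_l, so diagonal
    coordinates of elements of K lie in b.  A diagonal coordinate of
    U_{d[l] + e_(l+1)} k is n(d, c_l) up to diagonal coordinates of k; hence
    n(d, c_l) is in b for all d in C.  As C is finitely generated projective
    and the polarised norm is regular, C has a dual basis of the form
    c = sum_m n(x_m, c) y_m, and so c_l is in bC.  This is
    [her3_generated_by_scalars].

    The property descends from J (x) S to J along a faithfully flat R -> S
    ([generated_by_scalars_descent]).  For a U-stable submodule K of J put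
    a = {r | r 1 in K}; the S-span K_S of K is U-stable in J (x) S, hence
    generated by the products s x with s 1 in K_S.  Since R/a embeds in J/K by
    r |-> r 1, flatness shows that such an s becomes 0 in R/a (x) S; so K_S has
    image 0 in (J/aJ) (x) S, and K is contained in aJ because M -> M (x) S is
    injective for every M.  The reverse inclusion descends in the same way.

    Consequently an outer ideal I equals aJ, where a is its contraction, and
    every aJ is an ideal, by bilinearity of {x y z} in (x, z).  In the other
    direction r 1 in aJ implies r in a: over S a linear form taking the value 1
    on the unit, namely a diagonal coordinate, shows that r becomes 0 in
    R/a (x) S ([contraction_extension_descent]). *)

(** * Submodules and quotient modules *)

Section LinearFun.
Variables (R : comPzRingType) (M N : lmodType R) (g : M -> N).
Hypothesis hg : linear g.

Lemma linear_fun0 : g 0 = 0.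
Proof. by have := hg 1 0 0; rewrite scaler0 addr0 scale1r -[LHS]addr0 => /addrI. Qed.

Lemma linear_funD x y : g (x + y) = g x + g y.
Proof. by have := hg 1 x y; rewrite !scale1r. Qed.

Lemma linear_funZ a x : g (a *: x) = a *: g x.
Proof. by have := hg a x 0; rewrite linear_fun0 !addr0. Qed.
End LinearFun.

Section Submodule.
Variables (R : comPzRingType) (M : lmodType R) (N : set M).
Hypothesis hN : submodule N.

Lemma submodule0 : N 0. Proof. exact: hN.1. Qed.

Lemma submoduleD x y : N x -> N y -> N (x + y).
Proof. by move=> hx hy; rewrite -[x]scale1r; exact: hN.2. Qed.

Lemma submoduleZ a x : N x -> N (a *: x).
Proof. by move=> hx; rewrite -[_ *: _]addr0; apply: hN.2 => //; exact: hN.1. Qed.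

Lemma submoduleB x y : N x -> N y -> N (x - y).
Proof. by move=> hx hy; rewrite addrC -scaleN1r; exact: hN.2. Qed.

Lemma submodule_sum (I : finType) (F : I -> M) :
  (forall i, N (F i)) -> N (\sum_i F i).
Proof.
by move=> h; elim/big_ind: _ => //; [exact: submodule0|exact: submoduleD].
Qed.

Lemma lin_span_min (A : set M) :
  (forall x, A x -> N x) -> forall x, lin_span A x -> N x.
Proof.
move=> hA x [k [a [m [hm ->]]]]; apply: submodule_sum => i.
exact/submoduleZ/hA.
Qed.
End Submodule.

Section LinSpan.
Variables (R : comPzRingType) (M : lmodType R) (A : set M).

Lemma mem_lin_span x : A x -> lin_span A x.
Proof.
move=> hx; exists 1%N, (fun=> 1), (fun=> x); split=> //.
by rewrite big_ord_recl big_ord0 scale1r addr0.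
Qed.

Lemma lin_span_submodule : submodule (lin_span A).
Proof.
split; first by exists 0%N, (fun=> 0), (fun=> 0); split=> [[]//|]; rewrite big_ord0.
move=> c _ _ [k [a [m [hm ->]]]] [l [b [n [hn ->]]]].
exists (k + l)%N,
  (fun i => match fintype.split i with inl j => c * a j | inr j => b j end),
  (fun i => match fintype.split i with inl j => m j | inr j => n j end).
split=> [i|]; first by case: (fintype.split i).
rewrite big_split_ord scaler_sumr; congr (_ + _); apply: eq_bigr => i _.
  by rewrite (unsplitK (inl i)) scalerA.
by rewrite (unsplitK (inr i)).
Qed.
End LinSpan.

Section Quotient.
Variables (R : comPzRingType) (M : lmodType R) (N : set M).
Hypothesis hN : submodule N.

(** The proof of [submodule N] is an argument so that the additive closure of
    the predicate, and with it the quotient, can be a canonical instance. *)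
Definition submodule_pred of submodule N : {pred M} := fun x => `[< N x >].

Fact submodule_zmod_closed : zmod_closed (submodule_pred hN).
Proof.
split=> [|x y /asboolP hx /asboolP hy]; apply/asboolP; first exact: submodule0.
exact: submoduleB.
Qed.
HB.instance Definition _ :=
  GRing.isZmodClosed.Build M (submodule_pred hN) submodule_zmod_closed.

Definition quot_mod := Quotient.quot (submodule_pred hN).
HB.instance Definition _ := GRing.Zmodule.on quot_mod.

Definition quot_proj (x : M) : quot_mod := \pi_quot_mod x.

Lemma quot_projP x y : quot_proj x = quot_proj y <-> N (x - y).
Proof.
split=> [/eqquotP|h]; first by rewrite Quotient.equivE => /asboolP.
by apply/eqquotP; rewrite Quotient.equivE; apply/asboolP.
Qed.

Definition quot_scale (a : R) (x : quot_mod) : quot_mod :=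
  quot_proj (a *: repr x).

Lemma quot_projK (x : quot_mod) : quot_proj (repr x) = x.
Proof. exact: reprK. Qed.

Lemma quot_projD x y : quot_proj (x + y) = quot_proj x + quot_proj y.
Proof. by rewrite /quot_proj raddfD. Qed.

Lemma quot_scale_proj a x : quot_scale a (quot_proj x) = quot_proj (a *: x).
Proof.
apply/quot_projP; rewrite -scalerBr; apply: submoduleZ => //.
by apply/quot_projP; rewrite quot_projK.
Qed.

Fact quot_scaleA a b x : quot_scale a (quot_scale b x) = quot_scale (a * b) x.
Proof. by rewrite -(quot_projK x) !quot_scale_proj scalerA. Qed.
Fact quot_scale1 : left_id 1 quot_scale.
Proof. by move=> x; rewrite -(quot_projK x) quot_scale_proj scale1r. Qed.
Fact quot_scaleDr : right_distributive quot_scale +%R.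
Proof.
move=> a x y; rewrite -(quot_projK x) -(quot_projK y) -quot_projD.
by rewrite !quot_scale_proj scalerDr quot_projD.
Qed.
Fact quot_scaleDl x : {morph quot_scale^~ x : a b / a + b}.
Proof.
by move=> a b; rewrite -(quot_projK x) !quot_scale_proj scalerDl quot_projD.
Qed.
HB.instance Definition _ := GRing.Zmodule_isLmodule.Build R quot_mod
  quot_scaleA quot_scale1 quot_scaleDr quot_scaleDl.

Fact quot_proj_linear : linear quot_proj.
Proof. by move=> a x y; rewrite quot_projD -quot_scale_proj. Qed.
HB.instance Definition _ :=
  GRing.isLinear.Build R M quot_mod _ quot_proj quot_proj_linear.

Lemma quot_proj_eq0 x : quot_proj x = 0 <-> N x.
Proof. by rewrite -{2}[x]subr0 -quot_projP linear0. Qed.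

Section QuotLift.
Variables (P : lmodType R) (g : {linear M -> P}).
Hypothesis gN : forall x, N x -> g x = 0.

(** The proof that g kills N is an argument so that linearity can be a canonical
    instance; g is evaluated at the chosen representative. *)
Definition quot_lift of (forall x, N x -> g x = 0) : quot_mod -> P :=
  fun x => g (repr x).

Lemma quot_liftE x : quot_lift gN (quot_proj x) = g x.
Proof.
apply/eqP; rewrite -subr_eq0 -linearB; apply/eqP/gN/quot_projP.
exact: quot_projK.
Qed.

Fact quot_lift_linear : linear (quot_lift gN).
Proof.
move=> a x y; rewrite -(quot_projK x) -(quot_projK y) -linearP.
by rewrite !quot_liftE linearP.
Qed.
HB.instance Definition _ :=
  GRing.isLinear.Build R quot_mod P _ (quot_lift gN) quot_lift_linear.

Lemma quot_lift_inj : (forall x, g x = 0 -> N x) -> injective (quot_lift gN).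
Proof.
move=> h x y; rewrite -(quot_projK x) -(quot_projK y) !quot_liftE => e.
by apply/quot_projP/h; rewrite linearB e subrr.
Qed.
End QuotLift.
End Quotient.
Arguments quot_lift {R M N} hN {P g} gN x : simpl never.

(** * Faithfully flat descent of membership in submodules *)

Section OrbitMap.
Variables (R : comPzRingType) (M : lmodType R) (m : M).

Definition orbit_map (r : R^o) : M := r *: m.

Fact orbit_map_linear : linear orbit_map.
Proof. by move=> a r s; rewrite /orbit_map scalerDl scalerA. Qed.
HB.instance Definition _ :=
  GRing.isLinear.Build R R^o M _ orbit_map orbit_map_linear.
End OrbitMap.

Section Descent.
Variables (R S : comPzRingType) (f : {rmorphism R -> S}).

(** Flatness applied to the embedding of R / ann(m) in M turns m (x) 1 = 0 into
    1 (x) 1 = 0 in R / ann(m) (x) S.  This tensor product is then 0, hence so is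
    R / ann(m) by faithfulness, and m = 1 m = 0. *)
Lemma ffl_tens_eq0 (M : lmodType R) (m : M) :
  faithfully_flat f -> tens f m 1 = 0 -> m = 0.
Proof.
case=> ffl ff0 hm; pose A : set R^o := [set r : R^o | r *: m = 0].
have hA : submodule A.
  split=> [|a x y]; first exact: scale0r.
  by rewrite /A /= => hx hy; rewrite scalerDl -scalerA hx hy scaler0 addr0.
have gA r : A r -> orbit_map m r = 0 by [].
have ginj : injective (quot_lift hA gA) by apply: quot_lift_inj.
have h0 (x : tensor f (quot_mod hA)) : x = 0.
  have e1 : tens f (quot_proj hA (1 : R^o)) 1 = 0.
    apply: (ffl _ _ _ ginj); rewrite tmapE linear0 /= quot_liftE.
    by apply: etrans hm; congr (tens f _ _); exact: scale1r.
  elim/tensor_ind: x => [//|q s|x y -> ->]; last exact: addr0.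
  rewrite -(quot_projK q); set r := repr q.
  have -> : quot_proj hA r = (r : R) *: quot_proj hA (1 : R^o).
    by rewrite -linearZ; congr quot_proj; rewrite -[RHS]/(_ * _) mulr1.
  by rewrite tens_bal -[_ * s]mulr1 -tens_scale e1 scaler0.
by have := (quot_proj_eq0 hA 1).1 (ff0 _ h0 _); rewrite /A /= scale1r.
Qed.

Lemma ffl_tens_inj (M : lmodType R) :
  faithfully_flat f -> injective (fun m : M => tens f m 1).
Proof.
move=> ffl m m' e; apply/eqP; rewrite -subr_eq0; apply/eqP/ffl_tens_eq0 => //.
rewrite tensDl e -tensDl subrr; exact: tens0l.
Qed.

Variables (M : lmodType R) (N : set M).
Hypothesis hN : submodule N.

Definition base_span : set (tensor f M) :=
  lin_span [set tens f n 1 | n in N].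

Lemma base_span_submodule : submodule base_span.
Proof. exact: lin_span_submodule. Qed.

Lemma base_span_tens n s : N n -> base_span (tens f n s).
Proof.
move=> hn; rewrite -[s]mulr1 -tens_scale.
apply: submoduleZ; first exact: base_span_submodule.
by apply: mem_lin_span; exists n.
Qed.

Lemma base_span_kernel x : base_span x -> tmap f (quot_proj hN) x = 0.
Proof.
have hK : submodule [set x | tmap f (quot_proj hN) x = 0].
  split=> [|a y z] /=; first exact: linear0.
  by move=> hy hz; rewrite linearP /= hy hz scaler0 addr0.
apply: (lin_span_min hK) => _ [n hn <-] /=; rewrite tmapE /=.
by rewrite (quot_proj_eq0 hN n).2 // tens0l.
Qed.

(** Membership in N is the vanishing of a class in M / N, and by
    [ffl_tens_eq0] that can be tested after base change. *)
Lemma ffl_descent (m : M) :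
  faithfully_flat f -> tmap f (quot_proj hN) (tens f m 1) = 0 -> N m.
Proof. by move=> ffl; rewrite tmapE /= => /ffl_tens_eq0 h; exact/quot_proj_eq0/h. Qed.
End Descent.
Arguments base_span {R S} f {M} N _.
Arguments base_span_submodule {R S} f {M} N.
Arguments base_span_kernel {R S f M N} hN {x} _.
Arguments ffl_descent {R S f M N} hN {m} _ _.

(** * Submodules stable under the operators U_x *)

Section Paraquad.
Variables (R : comPzRingType) (J : paraquad R).

Definition U_stable (K : set J) : Prop :=
  submodule K /\ forall x k, K k -> K (pq_U x k).

(** Bilinearity of the polarisation of U.  It is established for Her_3(C), where
    the quadratic map is given by a formula, and then moved to J. *)
Definition triple_linear : Prop :=
  forall y z : J, linear (fun x => pq_triple x y z).

(** The property carried from Her_3(C) to J: stable submodules come from ideals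
    of the base ring. *)
Definition generated_by_scalars : Prop :=
  forall K : set J, U_stable K -> K = extension (J := J) (contraction K).

Lemma pq_U_lin (x : J) : linear (pq_U x).
Proof. by move=> a y z; exact: linearP. Qed.

Lemma pq_UZr (x y : J) a : pq_U x (a *: y) = a *: pq_U x y.
Proof. exact: linear_funZ (pq_U_lin x) a y. Qed.

Lemma pq_UZl a (x y : J) : pq_U (a *: x) y = a ^+ 2 *: pq_U x y.
Proof. by rewrite /pq_U quadZ endoZE. Qed.

Lemma pq_U0l (y : J) : pq_U 0 y = 0.
Proof. by have := pq_UZl 0 0 y; rewrite expr0n !scale0r. Qed.

Lemma pq_U1 (y : J) : pq_U (pq_one J) y = y.
Proof. exact: pq_quad1. Qed.

Lemma pq_UD (x y z : J) : pq_U (x + z) y = pq_U x y + pq_U z y + pq_triple x y z.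
Proof. by rewrite /pq_triple -(addrA (pq_U (x + z) y)) -opprD [RHS]addrC subrK. Qed.

Lemma pq_tripleC (x y z : J) : pq_triple x y z = pq_triple z y x.
Proof. by rewrite /pq_triple (addrC x) addrAC. Qed.

Lemma pq_triple_linm (x z : J) : linear (fun y => pq_triple x y z).
Proof.
move=> a y y'; rewrite /pq_triple !pq_U_lin !scalerBr !opprD.
by rewrite [RHS]addrACA; congr (_ + _); exact: addrACA.
Qed.

Lemma U_stable_triple (K : set J) x y k :
  U_stable K -> K k -> K (pq_triple x k y).
Proof. by case=> hK hU hk; apply: submoduleB; [|apply: submoduleB|]; auto. Qed.

Lemma contraction_submodule (K : set J) :
  submodule K -> ring_ideal R (contraction K).
Proof.
move=> hK; split; first by rewrite /contraction /= scale0r; exact: submodule0.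
move=> a r s hr hs; rewrite /contraction /= scalerDl -scalerA.
exact: hK.2.
Qed.

Lemma mem_extension (a : set R) r (x : J) : a r -> extension (J := J) a (r *: x).
Proof. by move=> hr; apply: mem_lin_span; exists r => //; exists x. Qed.

Lemma extension_submodule (a : set R) : submodule (extension (J := J) a).
Proof. exact: lin_span_submodule. Qed.

Lemma extension_min (a : set R) (N : set J) : submodule N ->
  (forall r x, a r -> N (r *: x)) -> forall x, extension (J := J) a x -> N x.
Proof. by move=> hN h; apply: (lin_span_min hN) => _ [r hr [x _ <-]]; exact: h. Qed.

Lemma outer_ideal_stable (I : set J) : pq_outer_ideal J I -> U_stable I.
Proof.
case=> hI e; split=> // x k hk; rewrite -e; exists (pq_U x k).
  by apply: mem_lin_span; exists x => //; exists k.
by exists 0; [exact: (lin_span_submodule _).1|rewrite addr0].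
Qed.

Section Extension.
Variable a : set R.
Hypothesis J3 : triple_linear.
Local Notation E := (extension (J := J) a).

Let hE : submodule E := extension_submodule a.

Lemma extension_U x e : E e -> E (pq_U x e).
Proof.
move: e; apply: (extension_min (N := [set e | E (pq_U x e)])) => [|r y hr] /=.
  split=> [|c y z hy hz] /=; last by rewrite pq_U_lin; exact: hE.2.
  by rewrite (linear_fun0 (pq_U_lin x)); exact: hE.1.
by rewrite pq_UZr; exact: mem_extension.
Qed.

Lemma triple_linr (x y : J) : linear (pq_triple x y).
Proof. by move=> c z z'; rewrite !(pq_tripleC x); exact: J3. Qed.


Lemma extension_triple x y e : E e -> E (pq_triple x y e).
Proof.
move: e; apply: (extension_min (N := [set e | E (pq_triple x y e)])) => [|r z hr] /=.
  split=> [|c z z' hz hz'] /=; last by rewrite triple_linr; exact: hE.2.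
  by rewrite (linear_fun0 (triple_linr x y)); exact: hE.1.
by rewrite (linear_funZ (triple_linr x y)); exact: mem_extension.
Qed.

(** U_(r x) = r^2 U_x handles the generators.  A sum of elements of aJ also
    produces mixed terms {x y z} with z in aJ, so membership in aJ is carried
    along in the induction. *)
Lemma extension_U_inner e y : E e -> E (pq_U e y).
Proof.
move=> he; suff: E e /\ forall y, E (pq_U e y) by case.
move: e he; apply: extension_min => [|r x hr].
  split=> [|c x z [hx Ux] [hz Uz]].
    by split=> [|z]; [exact: hE.1|rewrite pq_U0l; exact: hE.1].
  split=> [|w]; first exact: hE.2.
  rewrite pq_UD pq_UZl; apply: submoduleD => //; last exact: extension_triple.
  exact: hE.2.
split=> [|z]; first exact: mem_extension.
by rewrite pq_UZl expr2 -scalerA; exact: mem_extension.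
Qed.

Lemma extension_outer_ideal : pq_outer_ideal J E.
Proof.
split=> //; apply/seteqP; split=> [_ [u hu [v hv <-]]|x hx].
  apply: submoduleD => //.
    by apply: (lin_span_min hE) hu => _ [x _ [e he <-]]; exact: extension_U.
  by apply: (lin_span_min hE) hv => _ [x [y [z [hz ->]]]]; exact: extension_triple.
exists x; last by exists 0; [exact: (lin_span_submodule _).1|rewrite addr0].
by apply: mem_lin_span; exists (pq_one J) => //; exists x => //; rewrite pq_U1.
Qed.

Lemma extension_ideal : pq_ideal E.
Proof.
case: extension_outer_ideal => _ eE; split=> //; apply/seteqP.
split=> [_ [_ [u hu [v hv <-]] [w hw <-]]|x].
  rewrite -addrA; apply: submoduleD => //; last first.
    by rewrite -{1}eE; exists v => //; exists w.
  by apply: (lin_span_min hE) hu => _ [e he [x _ <-]]; exact: extension_U_inner.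
rewrite -{1}eE => -[v hv [w hw <-]]; exists v; last by exists w.
by exists 0; [exact: (lin_span_submodule _).1|exists v => //; rewrite add0r].
Qed.
End Extension.
End Paraquad.
Arguments triple_linear {R} J.
Arguments generated_by_scalars {R} J.

(** * Transport along isomorphisms *)

Section Isom.
Variables (R : comPzRingType) (J J' : paraquad R) (phi : {linear J -> J'}).
Hypothesis phi_bij : bijective phi.
Hypothesis phi1 : phi (pq_one J) = pq_one J'.
Hypothesis phiU : forall x y, phi (pq_U x y) = pq_U (phi x) (phi y).

Let phi_inj : injective phi := bij_inj phi_bij.

Let image_mem (A : set J) x : (phi @` A) (phi x) <-> A x.
Proof. by split=> [[z hz /phi_inj <-]|] //; exists x. Qed.

Let image_submodule (A : set J) : submodule A -> submodule (phi @` A).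
Proof.
move=> hA; split=> [|a _ _ [x hx <-] [y hy <-]].
  by exists 0; [exact: hA.1|rewrite linear0].
by exists (a *: x + y); [exact: hA.2|rewrite linearP].
Qed.

Let phi_triple x y z : phi (pq_triple x y z) = pq_triple (phi x) (phi y) (phi z).
Proof. by rewrite /pq_triple !linearB !phiU linearD. Qed.

Lemma triple_linear_isom : triple_linear J' -> triple_linear J.
Proof.
by move=> h y z a x x'; apply: phi_inj; rewrite linearP !phi_triple linearP h.
Qed.

Lemma generated_by_scalars_isom :
  generated_by_scalars J' -> generated_by_scalars J.
Proof.
case: (phi_bij) => psi phiK psiK h K [hK KU].
have K'e : phi @` K = extension (J := J') (contraction K).
  have -> : contraction K = contraction (phi @` K).
    apply/funext => r; rewrite -[RHS]/((phi @` K) (r *: pq_one J')) -phi1.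
    by rewrite -linearZ; exact/esym/propext/image_mem.
  apply: h; split=> [|x _ [k hk <-]]; first exact: image_submodule.
  by rewrite -(psiK x) -phiU; exists (pq_U (psi x) k) => //; exact: KU.
apply/seteqP; split=> x hx.
  have := (image_mem K x).2 hx; rewrite K'e => hx'; apply/image_mem.
  have hN := image_submodule (extension_submodule J (contraction K)).
  apply: (extension_min hN _ hx') => r y hr.
  rewrite -(psiK y) -linearZ; apply/image_mem; exact: mem_extension.
apply: (extension_min hK) hx => r y hr; apply/image_mem; rewrite K'e linearZ.
exact: mem_extension.
Qed.
End Isom.

(** * Base change of stable submodules *)

Section BaseChange.
Variables (R S : comPzRingType) (f : {rmorphism R -> S}) (J : paraquad R).
Local Notation JS := (pq_bc f J).

Lemma pq_U_bc (x y : J) t :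
  pq_U (J := JS) (tens f x 1) (tens f y t) = tens f (pq_U x y) t.
Proof. exact: pq_bc_quadE. Qed.

Lemma pq_triple_bc (x y z : J) t :
  pq_triple (J := JS) (tens f x 1) (tens f y t) (tens f z 1) =
  tens f (pq_triple x y z) t.
Proof.
have tensN (m m' : J) : tens f (m - m') t = tens f m t - tens f m' t.
  by apply/eqP; rewrite eq_sym subr_eq -tensDl subrK.
by rewrite /pq_triple -tensDl !pq_U_bc !tensN.
Qed.

(** J embeds in J (x) S, compatibly with {x y z}. *)
Lemma triple_linear_descent :
  faithfully_flat f -> triple_linear JS -> triple_linear J.
Proof.
move=> ffl h y z a x x'; apply: (ffl_tens_inj ffl) => /=.
rewrite [RHS]tensDl tens_bal -tens_scale -!pq_triple_bc -h.
by rewrite tensDl tens_bal -tens_scale.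
Qed.

(** Expanding U_x at x = sum_i m_i (x) s_i leaves the operators U_(m_i) and
    y |-> {m_i y m_j}, which map K to K; so the induction treats {x k z}
    first. *)
Lemma base_span_stable (K : set J) :
  triple_linear JS -> U_stable K -> U_stable (J := JS) (base_span f K).
Proof.
move=> h3 hKU; have [hK hU] := hKU.
have hE : submodule (M := JS) (base_span f K) := base_span_submodule f K.
have h3r (x y : JS) : linear (pq_triple x y) by exact: triple_linr.
have preim (g : JS -> JS) : linear g ->
    (forall i, K i -> base_span f K (g (tens f i 1))) ->
    forall k, base_span f K k -> base_span f K (g k).
  move=> gl hg; apply: (lin_span_min (N := [set k | base_span f K (g k)])).
    split=> [|c u v hu hv] /=; first by rewrite linear_fun0 //; exact: hE.1.
    by rewrite gl; exact: hE.2.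
  by move=> _ [i hi <-]; exact: hg.
have h_triple (x k z : JS) : base_span f K k -> base_span f K (pq_triple x k z).
  apply: (preim (fun k => pq_triple x k z)) => [|i hi]; first exact: pq_triple_linm.
  elim/tensor_ind: x => [|m s|x x' hx hx'].
  - by rewrite (linear_fun0 (h3 _ z)); exact: hE.1.
  - rewrite -[s]mulr1 -tens_scale (linear_funZ (h3 _ z)); apply: submoduleZ => //.
    elim/tensor_ind: z => [|m' s'|z z' hz hz'].
    + by rewrite (linear_fun0 (h3r _ _)); exact: hE.1.
    + rewrite -[s']mulr1 -tens_scale (linear_funZ (h3r _ _)); apply: submoduleZ => //.
      by rewrite pq_triple_bc; apply: base_span_tens; exact: U_stable_triple.
    + by rewrite (linear_funD (h3r _ _)); exact: submoduleD.
  - by rewrite (linear_funD (h3 _ z)); exact: submoduleD.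
split=> // x k hk; elim/tensor_ind: x => [|m s|x x' hx hx'].
- by rewrite pq_U0l; exact: hE.1.
- rewrite -[s]mulr1 -tens_scale pq_UZl; apply: submoduleZ => //.
  move: k hk; apply: preim => [|i hi]; first exact: pq_U_lin.
  by rewrite pq_U_bc; apply: base_span_tens; exact: hU.
- by rewrite pq_UD; apply: submoduleD; [|apply: submoduleD|exact: h_triple].
Qed.

(** With a the contraction of K, the map R/a -> J/K, r |-> r 1, is injective and
    stays so after flat base change; it sends 1 (x) s to the class of s 1, which
    vanishes. *)
Lemma contraction_bc_flat (K : set J) (hK : submodule K) s : flat f ->
  contraction (J := JS) (base_span f K) s ->
  tens f (quot_proj (contraction_submodule hK) (1 : R^o)) s = 0.
Proof.
move=> ffl hs; set a := contraction K; set ha := contraction_submodule hK.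
pose g : {linear R^o -> quot_mod hK} := orbit_map (quot_proj hK (pq_one J)).
have gE r : g r = quot_proj hK (r *: pq_one J) by rewrite linearZ.
have g0 r : a r -> g r = 0 by rewrite gE => hr; exact/quot_proj_eq0.
have ginj : injective (quot_lift ha g0).
  by apply: quot_lift_inj => r; rewrite gE => /quot_proj_eq0.
apply: (ffl _ _ _ ginj); rewrite tmapE linear0 /= quot_liftE gE scale1r.
have := base_span_kernel hK hs.
by rewrite /= tens_scale mulr1 tmapE.
Qed.

(** Both inclusions are tested after base change.  For K <= aJ, an element of
    K_S is a combination of s (m (x) t) with 1 (x) s = 0 in R/a (x) S; applying
    the map R/a -> J/aJ, r |-> r m, gives m (x) s = 0 in (J/aJ) (x) S. *)
Lemma generated_by_scalars_descent : faithfully_flat f ->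
  triple_linear JS -> generated_by_scalars JS -> generated_by_scalars J.
Proof.
move=> ffl h3 hgen K hKU; have [hK hU] := hKU.
have KSe := hgen _ (base_span_stable h3 hKU).
apply/seteqP; split=> [x hx|].
  have hE := extension_submodule J (contraction K).
  apply: (ffl_descent hE ffl).
  have : base_span f K (tens f x 1) by exact: base_span_tens.
  rewrite KSe; move: (tens f x 1) => {hx}x.
  apply: (extension_min (J := JS) (N := [set x | tmap f (quot_proj hE) x = 0])).
    split=> [|c u v] /=; first exact: linear0.
    by move=> hu hv; rewrite linearP /= hu hv scaler0 addr0.
  move=> s y /(contraction_bc_flat hK ffl.1) hs /=; rewrite linearZ /=.
  elim/tensor_ind: y => [|m t|y y' hy hy']; last 1 first.
  - by rewrite linearD scalerDr /= hy hy' addr0.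
  - by rewrite linear0 scaler0.
  pose g : {linear R^o -> quot_mod hE} := orbit_map (quot_proj hE m).
  have gE r : g r = quot_proj hE (r *: m) by rewrite linearZ.
  have g0 r : contraction K r -> g r = 0.
    by rewrite gE => hr; apply/quot_proj_eq0/mem_extension.
  have := congr1 (tmap f (quot_lift (contraction_submodule hK) g0)) hs.
  rewrite tmapE linear0 /= quot_liftE gE scale1r => e.
  by rewrite tmapE tens_scale mulrC -tens_scale e scaler0.
apply: extension_min => // r y hr; apply: (ffl_descent hK ffl).
apply: base_span_kernel; rewrite KSe tens_bal -tens_scale.
apply: (mem_extension (J := JS)); rewrite /contraction /= tens_scale -tens_bal.
exact: base_span_tens.
Qed.

(** If r 1 is in aJ, the linear form lambda sends r 1 (x) 1 to the image of r in
    S, which is therefore a combination of images of elements of a; so r becomes 0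
    in (R/a) (x) S. *)
Lemma contraction_extension_descent (lambda : {linear JS -> S^o}) (a : set R) :
  faithfully_flat f -> lambda (pq_one JS) = 1 -> ring_ideal R a ->
  contraction (extension (J := J) a) = a.
Proof.
move=> ffl l1 ha; apply/seteqP; split=> r; last by move=> hr; exact: mem_extension.
move=> hr; apply: (ffl_descent ha ffl).
have -> : tens f (r : R^o) 1 = tens f (1 : R^o) (lambda (tens f (r *: pq_one J) 1)).
  rewrite tens_bal -tens_scale linearZ /= l1.
  have e : (r : R^o) = r *: (1 : R^o) by exact/esym/mulr1.
  by rewrite {1}e tens_bal.
move: hr; rewrite /contraction /=; move: (r *: pq_one J).
apply: (extension_min (N := [set x | tmap f (quot_proj ha)
  (tens f (1 : R^o) (lambda (tens f x 1))) = 0])).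
  split=> [|c u v /= hu hv] /=.
    by rewrite tens0l linear0 -(mul0r (1 : S)) -tens_scale scale0r linear0.
  rewrite tensDl tens_bal -tens_scale linearP tensDr linearD /= hv addr0.
  by rewrite -tens_scale linearZ /= hu scaler0.
move=> c x hc /=; rewrite tens_bal -tens_scale linearZ /=.
rewrite -[_ *: _]/(f c * _) -tens_bal tmapE /=.
have -> : c *: (1 : R^o) = c :> R^o by exact: mulr1.
by rewrite (quot_proj_eq0 ha c).2 // tens0l.
Qed.
End BaseChange.

(** * Hermitian 3 x 3 matrices over a composition algebra *)

Section CompAlg.
Variables (R : comPzRingType) (C : compalg R).

Lemma ca_polarC (x y : C) : ca_polar x y = ca_polar y x.
Proof. exact: polarC. Qed.

Lemma ca_polar0r (x : C) : ca_polar x 0 = 0.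
Proof. exact: (linear_fun0 (ca_polar_lin x)). Qed.

Lemma ca_polar0l (x : C) : ca_polar 0 x = 0.
Proof. by rewrite ca_polarC ca_polar0r. Qed.

Lemma ca_mul0l (x : C) : ca_mul 0 x = 0.
Proof. exact: (linear_fun0 (ca_mul_linl x)). Qed.

Lemma ca_mul0r (x : C) : ca_mul x 0 = 0.
Proof. exact: (linear_fun0 (ca_mul_linr x)). Qed.

Lemma ca_conj0 : ca_conj (0 : C) = 0.
Proof. by rewrite /ca_conj /ca_tr ca_polar0l scale0r subr0. Qed.

Lemma ca_norm0 : ca_norm C 0 = 0 :> R.
Proof. by rewrite -(scale0r (0 : C)) quadZ expr0n scale0r. Qed.

(** A section of a surjection R^n -> C splits off coordinate forms on C, and
    regularity of the norm writes each of them as n(x, -). *)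
Lemma ca_dual_basis : exists (n : nat) (x e : 'I_n -> C),
  forall c, c = \sum_i ca_polar (x i) c *: e i.
Proof.
have [n [e he]] := ca_fin_gen C.
pose p (v : 'rV[R^o]_n) : C := \sum_i v 0 i *: e i.
have p_lin : linear p.
  move=> a u v; rewrite /p scaler_sumr -big_split; apply: eq_bigr => i _.
  by rewrite !mxE scalerDl scalerA.
pose pL : {linear 'rV[R^o]_n -> C} :=
  HB.pack_for {linear 'rV[R^o]_n -> C} p (GRing.isLinear.Build R _ C _ p p_lin).
have [|h hh] := @ca_projective R C _ _ pL idfun.
  move=> c; have [a ->] := he c; exists (\row_i a i : 'rV[R^o]_n).
  by apply: eq_bigr => i _; rewrite mxE.
have coord i : exists x : C, forall c, ca_polar x c = h c 0 i.
  have l_lin : linear (fun c => h c 0 i : R^o).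
    by move=> a u v; rewrite linearP !mxE.
  have [x [hx _]] := ca_polar_bij
    (HB.pack_for {linear C -> R^o} (fun c => h c 0 i : R^o)
      (GRing.isLinear.Build R C R^o _ _ l_lin)).
  by exists x.
have [x hx] := choice coord; exists n, x, e => c.
by rewrite -{1}[c]hh; apply: eq_bigr => i _; rewrite hx.
Qed.
End CompAlg.

Section Her3.
Variables (R : comPzRingType) (C : compalg R).
Local Notation H := (her3_mod C).
Local Notation n := (ca_norm C).

Lemma her3P (x y : H) :
  (forall i, hdiag x i = hdiag y i) -> (forall i, hoff x i = hoff y i) -> x = y.
Proof.
case: x y => [a c] [b d] h1 h2; congr (_, _); apply/ffunP => i.
  exact: h1.
exact: h2.
Qed.

Lemma hdiagD (x y : H) i : hdiag (x + y) i = hdiag x i + hdiag y i.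
Proof. by rewrite /hdiag /= !ffunE. Qed.
Lemma hoffD (x y : H) i : hoff (x + y) i = hoff x i + hoff y i.
Proof. by rewrite /hoff /= !ffunE. Qed.
Lemma hdiagN (x : H) i : hdiag (- x) i = - hdiag x i.
Proof. by rewrite /hdiag /= !ffunE. Qed.
Lemma hoffN (x : H) i : hoff (- x) i = - hoff x i.
Proof. by rewrite /hoff /= !ffunE. Qed.
Lemma hdiagZ a (x : H) i : hdiag (a *: x) i = a * hdiag x i.
Proof. by rewrite /hdiag /= !ffunE. Qed.
Lemma hoffZ a (x : H) i : hoff (a *: x) i = a *: hoff x i.
Proof. by rewrite /hoff /= !ffunE. Qed.
Lemma hdiag_mk a c i : hdiag (mk_her3 a c : H) i = a i.
Proof. by rewrite /hdiag /= ffunE. Qed.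
Lemma hoff_mk a c i : hoff (mk_her3 a c : H) i = c i.
Proof. by rewrite /hoff /= ffunE. Qed.
Definition her3_coordE :=
  (hdiagD, hoffD, hdiagN, hoffN, hdiagZ, hoffZ, hdiag_mk, hoff_mk).

Definition her3_diag (i : 'I_3) : H := mk_her3 (fun j => (j == i)%:R) (fun=> 0).
Definition her3_off (l : 'I_3) (d : C) : H :=
  mk_her3 (fun=> 0) (fun j => if j == l then d else 0).
Local Notation e := her3_diag.
Local Notation off := her3_off.

Lemma ord3_shift (i : 'I_3) :
  [/\ i + 1 + 1 = i + 2%:R, i + 1 + 2%:R = i, i + 2%:R + 1 = i &
      i + 2%:R + 2%:R = i + 1].
Proof. by case: i => [[|[|[|//]]] hi]; split; exact/val_inj. Qed.

Lemma ord3_neq (i : 'I_3) :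
  [/\ (i + 1 == i) = false, (i + 2%:R == i) = false & (i + 1 == i + 2%:R) = false].
Proof. by case: i => [[|[|[|//]]] hi]; split. Qed.

Lemma ord3_cases (i j : 'I_3) : [\/ j = i, j = i + 1 | j = i + 2%:R].
Proof.
case: i j => [[|[|[|//]]] hi] [[|[|[|//]]] hj];
  first [ by apply: Or31; apply: val_inj
        | by apply: Or32; apply: val_inj
        | by apply: Or33; apply: val_inj ].
Qed.

Lemma ord3_sum (V : zmodType) (F : 'I_3 -> V) i :
  \sum_j F j = F i + F (i + 1) + F (i + 2%:R).
Proof.
have [h1 h2 h3] := ord3_neq i.
rewrite (bigD1 i) //= (bigD1 (i + 1)) /=; last by rewrite h1.
rewrite (bigD1 (i + 2%:R)) /=; last first.
  by rewrite h2 eq_sym h3.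
(* A bare addrA would also match i + 2, since 2 unfolds to 1 + 1. *)
rewrite big1 => [|j]; first by rewrite addr0 (addrA (F i)).
by have [->|->|->] := ord3_cases i j; rewrite ?eqxx /= ?andbF.
Qed.

Lemma her3_cross_lin y : linear (fun x : H => her3_cross x y).
Proof. exact: (her3_sharp_quad C).2. Qed.

Lemma her3_sharp_diag i : her3_sharp (e i) = 0.
Proof.
apply: her3P => j; rewrite !her3_coordE ?ca_norm0 ?scaler0 ?ca_mul0l ?ca_conj0.
  rewrite subr0; have [h1 h2 h3] := ord3_neq j.
  have [h4 h5 h6 h7] := ord3_shift j.
  have [->|->|->] := ord3_cases j i; rewrite ?h1 ?h2 ?h3 ?mul0r ?mulr0 //.
  by rewrite eq_sym h3 mulr0.
by rewrite oppr0 addr0.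
Qed.

Lemma her3_cross0 y : her3_cross (0 : H) y = 0.
Proof. exact: (linear_fun0 (her3_cross_lin y)). Qed.

Lemma her3_crossZ a (x y : H) : her3_cross (a *: x) y = a *: her3_cross x y.
Proof. exact: (linear_funZ (her3_cross_lin y)). Qed.

Lemma her3_crossZr a (x y : H) : her3_cross x (a *: y) = a *: her3_cross x y.
Proof. by rewrite /her3_cross !(polarC _ x) -/(her3_cross _ _) her3_crossZ. Qed.

Lemma her3_U_diag i k : her3_U (e i) k = hdiag k i *: e i.
Proof.
rewrite /her3_U her3_sharp_diag her3_cross0 subr0; congr (_ *: _).
have [h1 h2 h3] := ord3_neq i.
rewrite /her3_T (ord3_sum _ i) !her3_coordE !ca_polar0l eqxx h1 h2.
by rewrite !mul0r !addr0 mul1r.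
Qed.

Lemma her3_cross_diag l (k : H) i :
  hdiag (her3_cross (e l) k) i =
  (i + 1 == l)%:R * hdiag k (i + 2%:R) + (i + 2%:R == l)%:R * hdiag k (i + 1).
Proof.
rewrite /her3_cross /polar her3_sharp_diag subr0 !her3_coordE !add0r.
have h0 : (i + 1 == l)%:R * (i + 2%:R == l)%:R = 0 :> R.
  have [_ _ h] := ord3_neq i.
  by case: eqP => [<-|_]; rewrite ?mul0r // eq_sym h mulr0.
by rewrite mulrDl mulrDr h0 add0r; move: (n _ : R) => t; ring.
Qed.

Lemma her3_cross_diag_off l (k : H) i :
  hoff (her3_cross (e l) k) i = - ((i == l)%:R *: hoff k i).
Proof.
rewrite /her3_cross /polar her3_sharp_diag subr0 !her3_coordE !add0r.
by rewrite scalerDl opprD -(addrA (- (_ *: _))) addrK.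
Qed.

Lemma her3_cross_diag_diag l : her3_cross (e l) (e (l + 1)) = e (l + 2%:R).
Proof.
have [h1 h2 h3] := ord3_neq l; have [h4 h5 h6 h7] := ord3_shift l.
apply: her3P => i; last by rewrite her3_cross_diag_off !her3_coordE scaler0 oppr0.
rewrite her3_cross_diag !her3_coordE.
have [->|->|->] := ord3_cases l i; rewrite ?h4 ?h5 ?h6 ?h7 ?eqxx ?h1 ?h2 ?h3;
  rewrite ?[l == _]eq_sym ?[l + 2%:R == l + 1]eq_sym ?h1 ?h2 ?h3 ?eqxx /=; ring.
Qed.

Lemma her3_cross_diag_one l :
  her3_cross (e l) (her3_one C) = e (l + 1) + e (l + 2%:R).
Proof.
have [h1 h2 h3] := ord3_neq l; have [h4 h5 h6 h7] := ord3_shift l.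
apply: her3P => i; last first.
  by rewrite her3_cross_diag_off !her3_coordE scaler0 oppr0 addr0.
rewrite her3_cross_diag !her3_coordE.
have [->|->|->] := ord3_cases l i; rewrite ?h4 ?h5 ?h6 ?h7 ?eqxx ?h1 ?h2 ?h3;
  rewrite ?[l == _]eq_sym ?[l + 2%:R == l + 1]eq_sym ?h1 ?h2 ?h3 ?eqxx /=; ring.
Qed.

Lemma her3_sharp_off l d t :
  her3_sharp (off l d + t *: e (l + 1)) = - (n d : R) *: e l.
Proof.
have [h1 h2 h3] := ord3_neq l; have [h4 h5 h6 h7] := ord3_shift l.
apply: her3P => i; rewrite !her3_coordE.
  rewrite scaler0 addr0 !add0r.
  have [->|->|->] := ord3_cases l i; rewrite ?h4 ?h5 ?h6 ?h7 ?eqxx ?h1 ?h2 ?h3;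
  rewrite ?[l == _]eq_sym ?[l + 2%:R == l + 1]eq_sym ?h1 ?h2 ?h3 ?ca_norm0 /=;
  by move: (n _ : R) => u; ring.
rewrite !scaler0 !addr0 add0r.
have [->|->|->] := ord3_cases l i; rewrite ?h4 ?h5 ?h6 ?h7 ?eqxx ?h1 ?h2 ?h3;
  rewrite ?[l == _]eq_sym ?h1 ?h2 ?h3 ?ca_mul0l ?ca_mul0r ?ca_conj0;
  by rewrite ?scaler0 ?mulr0 ?scale0r ?oppr0 ?addr0.
Qed.

(** t = 0, d = 1 gives the operator U_(1[l]) that exchanges e_(l+1) and e_(l+2);
    t = 1 gives the one that reads off n(d, c_l). *)
Lemma her3_U_off l d t k :
  her3_U (off l d + t *: e (l + 1)) k =
  (ca_polar d (hoff k l) + t * hdiag k (l + 1)) *: (off l d + t *: e (l + 1))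
  + (n d : R) *: her3_cross (e l) k.
Proof.
rewrite /her3_U her3_sharp_off her3_crossZ scaleNr opprK; congr (_ *: _ + _).
have [h1 h2 h3] := ord3_neq l; have [h4 h5 h6 h7] := ord3_shift l.
rewrite /her3_T (ord3_sum _ l) !her3_coordE !scaler0 !addr0 h1 h2 !eqxx !ca_polar0l.
rewrite ?[l == _]eq_sym ?[l + 2%:R == l + 1]eq_sym h1 h3.
by move: (ca_polar _ _) => u /=; ring.
Qed.

Lemma her3_decomp (x : H) :
  x = \sum_i hdiag x i *: e i + \sum_i off i (hoff x i).
Proof.
apply: her3P => i; have [h1 h2 h3] := ord3_neq i.
  rewrite !(ord3_sum _ i) !her3_coordE eqxx ![i == _]eq_sym h1 h2 /=; ring.
rewrite !(ord3_sum _ i) !her3_coordE eqxx ![i == _]eq_sym h1 h2.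
by rewrite !scaler0 !addr0 !add0r.
Qed.

Lemma her3_off_lin l : linear (off l).
Proof.
move=> a x y; apply: her3P => i; rewrite !her3_coordE ?mulr0 ?addr0 //.
by case: (i == l); rewrite // scaler0 addr0.
Qed.

Lemma her3_one_diag i : her3_one C = e i + e (i + 1) + e (i + 2%:R).
Proof.
have [h1 h2 h3] := ord3_neq i.
apply: her3P => j; rewrite !her3_coordE ?addr0 //.
have [->|->|->] := ord3_cases i j; rewrite ?eqxx ?[i == _]eq_sym
  ?[i + 2%:R == i + 1]eq_sym ?h1 ?h2 ?h3 ?addr0 ?add0r //.
Qed.

Section Stable.
Variable K : set H.
Hypotheses (hK : submodule K) (KU : forall x k, K k -> K (her3_U x k)).
Local Notation b := [set s : R | K (s *: her3_one C)].

(** U_(1[l]) maps e_(l+1) to e_(l+2). *)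
Lemma stable_diag_shift s l : K (s *: e (l + 1)) -> K (s *: e (l + 2%:R)).
Proof.
move/(KU (off l (ca_one C) + 0 *: e (l + 1))); congr K.
rewrite her3_U_off ca_norm_one scale1r mul0r addr0 hoffZ hoff_mk scaler0 ca_polar0r.
by rewrite !scale0r add0r her3_crossZr her3_cross_diag_diag.
Qed.

Lemma stable_diag s i : K (s *: e i) -> b s.
Proof.
have [h4 h5 h6 h7] := ord3_shift i => h0.
have h1 : K (s *: e (i + 1)).
  have := @stable_diag_shift s (i + 2%:R); rewrite h6 h7; exact.
have h2 := stable_diag_shift h1.
rewrite /= (her3_one_diag i) !scalerDr.
by apply: submoduleD => //; apply: submoduleD.
Qed.

Lemma stable_diag_coord k i : K k -> b (hdiag k i).
Proof. by move=> hk; apply: (@stable_diag _ i); rewrite -her3_U_diag; exact: KU. Qed.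

(** n(d, c_l) is the coordinate l+1 of U_(d[l] + e_(l+1)) k minus the coordinate
    l+1 of k and n(d) times the coordinate l+2 of k. *)
Lemma stable_polar_coord k l d : K k -> b (ca_polar d (hoff k l)).
Proof.
move=> hk; have hb : submodule (M := R^o) b.
  split=> [|a r s /= hr hs]; first by rewrite /= scale0r; exact: submodule0.
  by rewrite scalerDl -scalerA; exact: hK.2.
have := stable_diag_coord (l + 1) (KU (off l d + 1 *: e (l + 1)) hk).
rewrite her3_U_off hdiagD !hdiagZ her3_cross_diag hdiagD hdiagZ !hdiag_mk.
have [h1 h2 h3] := ord3_neq l; have [h4 h5 h6 h7] := ord3_shift l.
rewrite h4 h5 h2 !eqxx /= => hs.
have h := submoduleB hb (submoduleB hb hs (stable_diag_coord (l + 1) hk))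
  (submoduleZ hb (n d : R) (stable_diag_coord (l + 2%:R) hk)).
move: h; congr b.
rewrite -[_ *: _]/((n d : R) * hdiag k (l + 2%:R)).
by move: (n d : R) (ca_polar _ _) => u v; ring.
Qed.

Lemma stable_sub_scalars k : K k -> extension (J := her3 C) b k.
Proof.
move=> hk; have hE : submodule (extension (J := her3 C) b) by exact: extension_submodule.
rewrite (her3_decomp k); apply: submoduleD => //; apply: submodule_sum => // i.
  by apply: (@mem_extension _ (her3 C)); exact: stable_diag_coord.
have [m [x [c hc]]] := ca_dual_basis C.
pose L : {linear C -> H} :=
  HB.pack_for {linear C -> H} (off i) (GRing.isLinear.Build R C H _ _ (her3_off_lin i)).
rewrite -[off i _]/(L _) (hc (hoff k i)) linear_sum; apply: submodule_sum => // j.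
rewrite linearZ; apply: (@mem_extension _ (her3 C)); exact: stable_polar_coord.
Qed.

(** U_(e_i) (s 1) = s e_i, and the off-diagonal s d[l] appears in
    U_(d[l] + e_(l+1)) (s 1) next to multiples of s e_j. *)
Lemma scalars_sub_stable s (x : H) : b s -> K (s *: x).
Proof.
move=> hs; have he i : K (s *: e i).
  have := KU (e i) hs.
  have -> // : her3_U (e i) (s *: her3_one C) = s *: e i.
  by rewrite her3_U_diag hdiagZ hdiag_mk mulr1.
have ho l d : K (s *: off l d).
  have hc : K (her3_cross (e l) (s *: her3_one C)).
    by rewrite her3_crossZr her3_cross_diag_one scalerDr; exact: submoduleD.
  have := KU (off l d + 1 *: e (l + 1)) hs.
  rewrite her3_U_off hoffZ hoff_mk scaler0 ca_polar0r add0r hdiagZ hdiag_mk.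
  rewrite mul1r mulr1 scale1r scalerDr => h.
  have := submoduleB hK (submoduleB hK h (submoduleZ hK (n d : R) hc)) (he (l + 1)).
  by rewrite !addrK.
rewrite (her3_decomp x) scalerDr !scaler_sumr; apply: submoduleD => //.
  apply: submodule_sum => // i; rewrite scalerA mulrC -scalerA.
  exact: submoduleZ.
exact: submodule_sum.
Qed.
End Stable.

Lemma her3_generated_by_scalars : generated_by_scalars (her3 C).
Proof.
move=> K [hK hU].
have KU (x k : H) : K k -> K (her3_U x k) by rewrite -her3_pqU; exact: hU.
apply/seteqP; split=> x; first exact: stable_sub_scalars.
apply: extension_min => // r y; exact: scalars_sub_stable.
Qed.

Lemma her3_triple_linear : triple_linear (her3 C).
Proof.
move=> y z a x x'; rewrite /pq_triple !her3_pqU.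
by have := her3_U_endoB z a x x' => /(congr1 (fun g : endo H => g y)).
Qed.
End Her3.

(** * Ideals of Freudenthal algebras *)

Section Freudenthal.
Variables (R : comPzRingType) (J : paraquad R).
Hypothesis hJ : freudenthal J.

Lemma freudenthal_ideals :
  [/\ triple_linear J, generated_by_scalars J &
      forall a, ring_ideal R a -> contraction (extension (J := J) a) = a].
Proof.
have [S [f [J' [ffl [C _ ->] [phi [bphi phi1 phiU]]]]]] := hJ.
have h3 : triple_linear (pq_bc f J).
  by apply: (triple_linear_isom bphi phiU); exact: her3_triple_linear.
split; first exact: triple_linear_descent ffl h3.
  apply: (generated_by_scalars_descent ffl h3).
  by apply: (generated_by_scalars_isom bphi phi1 phiU); exact: her3_generated_by_scalars.
have l_lin : linear (fun x => hdiag (phi x) 0 : S^o).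
  by move=> c x y; rewrite linearP hdiagD hdiagZ.
pose l : {linear pq_bc f J -> S^o} :=
  HB.pack_for {linear pq_bc f J -> S^o} (fun x => hdiag (phi x) 0 : S^o)
    (GRing.isLinear.Build S _ S^o _ _ l_lin).
move=> a; apply: (contraction_extension_descent (lambda := l) ffl).
by rewrite -[l _]/(hdiag (phi _) 0) phi1 /hdiag /= ffunE.
Qed.
End Freudenthal.

Theorem theorem8p3 (R : comPzRingType) (J : paraquad R) (hJ : freudenthal J) :
  (forall I : set J, pq_outer_ideal J I -> pq_ideal I) /\
  set_bij (pq_outer_ideal J) (ring_ideal R) (@contraction R J) /\
  set_bij (ring_ideal R) (pq_outer_ideal J) (@extension R J).
Proof.
have [J3 Jgen Jce] := freudenthal_ideals hJ.
have Iext (I : set J) : pq_outer_ideal J I -> extension (contraction I) = I.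
  by move=> /outer_ideal_stable /Jgen <-.
have Icontr (I : set J) : pq_outer_ideal J I -> ring_ideal R (contraction I).
  by case=> hI _; exact: contraction_submodule.
split=> [I hI|]; first by rewrite -(Iext I hI); exact: extension_ideal.
split; split.
- by move=> I hI; exact: Icontr.
- by move=> I I' /set_mem/Iext eI /set_mem/Iext eI' e; rewrite -eI -eI' e.
- by move=> a ha; exists (extension a); [exact: extension_outer_ideal|exact: Jce].
- by move=> a _; exact: extension_outer_ideal.
- by move=> a a' /set_mem/Jce ea /set_mem/Jce ea' e; rewrite -ea -ea' e.
- by move=> I hI; exists (contraction I); [exact: Icontr|exact: Iext].
Qed.
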